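(* Let $\chi\ge2$ be an integer and let $\mathcal{B}^{(\chi)}=(\mathcal{V},\mathcal{E})$ be the Bethe lattice of degree $\chi$, with a fixed root $r\in\mathcal{V}$. For $\xi\in\mathbb{N}$ let $\mathcal{B}^{(\chi)[\xi]}=(\mathcal{V}^{[\xi]},\mathcal{E}^{[\xi]})$ be the subtree induced by the vertices at graph distance at most $\xi$ from $r$, and let $d^{[\xi]}=|\mathcal{V}^{[\xi]}|$. Let $\boldsymbol{\lambda}=(\lambda_v)_{v\in\mathcal{V}}$ and $\boldsymbol{\alpha}=(\alpha_e)_{e\in\mathcal{E}}$ be admissible parameters with $\sup_{v\in\mathcal{V}}\lambda_v<\infty$ and $\sup_{e\in\mathcal{E}}\alpha_e<1$. For each $\xi\in\mathbb{N}$ let $\boldsymbol{N}^{[\xi]}\sim\mathrm{MPMRF}(\boldsymbol{\lambda},\boldsymbol{\alpha},\mathcal{B}^{(\chi)[\xi]})$ (with parameters restricted to $\mathcal{V}^{[\xi]}$ and $\mathcal{E}^{[\xi]}$), and let $X_v^{[\xi]}=\sum_{j=1}^{N_v^{[\xi]}}B_{v,j}$ for $v\in\mathcal{V}^{[\xi]}$, where for each $v$ the nonnegative variables $B_{v,1},B_{v,2},\dots$ are i.i.d. copies of $B_v$, the sequences for different $v$ are mutually independent and independent of $\boldsymbol{N}^{[\xi]}$, and $\sup_{v\in\mathcal{V}}\mathbb{E}[B_v^2]<\infty$. Let $S^{[\xi]}=\sum_{v\in\mathcal{V}^{[\xi]}}X_v^{[\xi]}$ and $W^{[\xi]}=S^{[\xi]}/d^{[\xi]}$.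 Then $\mathbb{E}[W^{[\xi]}]<\infty$ for every $\xi$, and $W^{[\xi]}$ converges in probability to $\mathbb{E}[W^{[\xi]}]$ as $\xi\to\infty$, that is, for every $\varepsilon>0$, $$\lim_{\xi\to\infty}\Pr\big(|W^{[\xi]}-\mathbb{E}[W^{[\xi]}]|>\varepsilon\big)=0.$$
   Context: The Bethe lattice of degree $\chi$ is the infinite tree in which every vertex has exactly $\chi$ neighbors. Edges are undirected, so $\alpha_{(u,v)}=\alpha_{(v,u)}$. Parameters are admissible if $\lambda_v>0$ for all vertices $v$ and $0<\alpha_{(u,v)}\le\min(\sqrt{\lambda_u/\lambda_v},\sqrt{\lambda_v/\lambda_u})$ for every edge $(u,v)$. Binomial thinning: for an $\mathbb{N}$-valued $Y$ and $\theta\in[0,1]$, $\theta\circ Y:=\sum_{j=1}^{Y}I_j^{(\theta)}$ with $(I_j^{(\theta)})_{j\ge1}$ i.i.d. Bernoulli($\theta$), independent of $Y$. For a finite tree $\mathcal{T}$ with admissible parameters, $\boldsymbol{N}\sim\mathrm{MPMRF}(\boldsymbol{\lambda},\boldsymbol{\alpha},\mathcal{T})$ means: for a choice of root $r$ (the resulting law does not depend on the choice), with $\mathrm{pa}(v)$ the parent of $v$ in $\mathcal{T}$ rooted at $r$, $N_r=L_r$ and $N_v=\big(\alpha_{(\mathrm{pa}(v),v)}\sqrt{\lambda_v/\lambda_{\mathrm{pa}(v)}}\big)\circ N_{\mathrm{pa}(v)}+L_v$ for $v\ne r$, where the $L_v$ are independent, $L_r\sim\mathrm{Poisson}(\lambda_r)$,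 $L_v\sim\mathrm{Poisson}\big(\lambda_v(1-\alpha_{(\mathrm{pa}(v),v)}\sqrt{\lambda_{\mathrm{pa}(v)}/\lambda_v})\big)$ for $v\neq r$, and the Bernoulli sequences used in the thinnings are mutually independent and independent of the $L_v$. A Poisson distribution with parameter $0$ is the point mass at $0$; empty sums are $0$. *)

(* Defs.v *)
From HB Require Import structures.
From mathcomp Require Import all_boot all_order all_algebra finmap.
From mathcomp Require Import all_classical all_reals all_analysis.

Set Implicit Arguments.
Unset Strict Implicit.
Unset Printing Implicit Defensive.

Import Order.TTheory GRing.Theory Num.Theory.
Import numFieldNormedType.Exports.

Local Open Scope classical_set_scope.
Local Open Scope ring_scope.

(** * Trees and the Bethe lattice *)

Section Graphs.
Context {V : choiceType}.
Implicit Types (adj : rel V) (T : {fset V}).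

(* [s] lists the vertices following [u] on a path without repeated vertex. *)
Definition simple_path adj (u v : V) (s : seq V) : Prop :=
  [/\ path adj u s, last u s = v & uniq (u :: s)].

Definition is_tree adj : Prop :=
  [/\ symmetric adj, irreflexive adj &
      forall u v : V, exists! s : seq V, simple_path adj u v s].

Definition is_bethe_lattice (chi : nat) adj : Prop :=
  [/\ infinite_set [set: V], is_tree adj &
      forall v : V, ([set w | adj v w] #= `I_chi)%card].

(* The graph distance from [u] to [v] is at most [n]. *)
Definition dist_le adj (u v : V) (n : nat) : Prop :=
  exists s : seq V, [/\ path adj u s, last u s = v & (size s <= n)%N].

(* [fset_set] is the expected finite set because balls of a locally finite
   graph are finite (it would be empty on an infinite set). *)
Definition ball_at adj (r : V) (n : nat) : {fset V} :=
  fset_set [set v | dist_le adj r v n].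

(* [p] is the parent of [v] in the subgraph induced by [T], rooted at [r]:
   the last vertex before [v] on the path from [r] to [v] inside [T].  The root
   has no parent. *)
Definition parent adj T (r p v : V) : Prop :=
  exists s : seq V, [/\ simple_path adj r v (rcons s v), last r s = p &
                        {subset r :: rcons s v <= T}].

Definition admissible {R : realType} adj (lam : V -> R) (alpha : V -> V -> R) :
    Prop :=
  [/\ forall v, 0 < lam v,
      forall u v, adj u v -> alpha u v = alpha v u &
      forall u v, adj u v ->
        0 < alpha u v <= Num.min (Num.sqrt (lam u / lam v))
                                 (Num.sqrt (lam v / lam u))].

End Graphs.

(** * Independence *)

Section Independence.
Context {d : measure_display} {Omega : measurableType d} {R : realType}.

(* Mutual independence of the families of events [F i], for [i] in [D]. *)
Definition independent {I : choiceType} (P : probability Omega R) (D : set I)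
    (F : I -> set (set Omega)) : Prop :=
  forall (J : {fset I}) (A : I -> set Omega),
    (forall i, i \in J -> D i /\ F i (A i)) ->
    P (\bigcap_(i in [set` J]) A i) = (\prod_(i <- J) P (A i))%E.

Definition sigma_rv {d' : measure_display} {E : measurableType d'}
    (X : Omega -> E) : set (set Omega) :=
  preimage_set_system setT X measurable.

Definition sigma_family {d' : measure_display} {E : measurableType d'}
    {I : Type} (D : set I) (X : I -> Omega -> E) : set (set Omega) :=
  <<s \bigcup_(i in D) sigma_rv (X i) >>.

End Independence.

(** * Binomial thinning and the MPMRF law *)

Definition thinning {Omega : Type} (I : nat -> Omega -> bool)
    (Y : Omega -> nat) (w : Omega) : nat :=
  (\sum_(j < Y w) I j w)%N.

Section MPMRF.
Context {R : realType} {V : choiceType}.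
Variables (lam : V -> R) (alpha : V -> V -> R) (adj : rel V) (T : {fset V}).

(* [inl v] stands for [L v] and [inr (v, j)] for the [j]-th Bernoulli variable
   used in the thinning defining [N v]. *)
Definition noise_index (r : V) : set (V + V * nat)%type :=
  [set i | match i with
           | inl v => v \in T
           | inr (v, _) => (v \in T) && (v != r)
           end].

Definition noise_sigma {d : measure_display} {Omega : measurableType d}
    (L : V -> Omega -> nat) (I : V -> nat -> Omega -> bool)
    (i : (V + V * nat)%type) : set (set Omega) :=
  match i with
  | inl v => sigma_rv (L v)
  | inr (v, j) => sigma_rv (I v j)
  end.

(* The stochastic representation, on the tree induced by [T].  The second
   argument of [poisson_prob] is unused in the library, and
   [poisson_prob 0 _] is the point mass at 0. *)
Definition mpmrf_representation {d : measure_display}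
    {Omega : measurableType d} (P : probability Omega R)
    (N : V -> Omega -> nat) : Prop :=
  exists (r : V) (L : V -> {RV P >-> nat}) (I : V -> nat -> {RV P >-> bool}),
    [/\ r \in T,
        independent P (noise_index r) (noise_sigma L (fun v j => I v j)),
        distribution P (L r) = poisson_prob (lam r) 0 :> (set nat -> \bar R),
        N r =1 L r &
        forall p v : V, parent adj T r p v ->
          [/\ distribution P (L v) =
                poisson_prob
                  (lam v * (1 - alpha p v * Num.sqrt (lam p / lam v))) 0
                :> (set nat -> \bar R),
              forall j, distribution P (I v j) =
                bernoulli_prob (alpha p v * Num.sqrt (lam v / lam p))
                :> (set bool -> \bar R) &
              forall w, N v w = (thinning (I v) (N p) w + L v w)%N]].

(* [(N v)_(v in T)] has the MPMRF law: it has the same joint law (given by its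
   probability mass function) as some family, possibly on another probability
   space, that satisfies the stochastic representation. *)
Definition is_mpmrf {d : measure_display} {Omega : measurableType d}
    (P : probability Omega R) (N : V -> Omega -> nat) : Prop :=
  exists (d' : measure_display) (Omega' : measurableType d')
         (P' : probability Omega' R) (N' : V -> Omega' -> nat),
    mpmrf_representation P' N' /\
    forall k : V -> nat,
      P [set w | forall v, v \in T -> N v w = k v] =
      P' [set w | forall v, v \in T -> N' v w = k v].

End MPMRF.

(** * Compound sums and their aggregate *)

Definition compound {Omega : Type} {R : realType} (N : Omega -> nat)
    (B : nat -> Omega -> R) (w : Omega) : R :=
  \sum_(j < N w) B j w.

Definition aggregate {Omega : Type} {R : realType} {V : choiceType}
    (T : {fset V}) (N : V -> Omega -> nat) (B : V -> nat -> Omega -> R)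
    (w : Omega) : R :=
  \sum_(v <- T) compound (N v) (B v) w.

Definition mean_aggregate {Omega : Type} {R : realType} {V : choiceType}
    (T : {fset V}) (N : V -> Omega -> nat) (B : V -> nat -> Omega -> R)
    (w : Omega) : R :=
  aggregate T N B w / #|` T|%:R.

(* [None] stands for the random vector [(N v)_(v in T)] and [Some v] for the
   whole sequence [(B v j)_j]. *)
Definition count_claims_sigma {d : measure_display} {Omega : measurableType d}
    {R : realType} {V : choiceType} (T : {fset V})
    (N : V -> Omega -> nat) (B : V -> nat -> Omega -> R) (i : option V) :
    set (set Omega) :=
  match i with
  | None => sigma_family [set` T] N
  | Some v => sigma_family [set: nat] (B v)
  end.

(* Main.v *)
(* By Chebyshev's inequality it suffices that the variance of [W] tends to 0.
   Peeling off the deeper of two vertices of the rooted tree, one edge at a time,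
   gives Cov(N_u, N_v) = sqrt(lam_u lam_v) times the product of the alpha's along
   the path from u to v, hence Cov(X_u, X_v) <= C abar^dist(u,v) with abar < 1.
   A ball of radius k has at most M_k vertices, uniformly in its centre, so
   splitting the double sum over (u, v) according to dist(u,v) <= k bounds the
   variance of [W] by C (M_k / d + abar^k), where d is the number of vertices.
   Since d tends to infinity, this is arbitrarily small. *)

Require Import Defs.
From HB Require Import structures.
From mathcomp Require Import all_boot all_order all_algebra finmap.
From mathcomp Require Import all_classical all_reals all_analysis.
From mathcomp Require Import measurable_realfun.
From mathcomp Require Import ring lra.

Set Implicit Arguments.
Unset Strict Implicit.
Unset Printing Implicit Defensive.

Import Order.TTheory GRing.Theory Num.Theory.
Import numFieldNormedType.Exports.

Local Open Scope classical_set_scope.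
Local Open Scope ring_scope.

(** * Measurability and independence *)

(** Counts and claims are nonnegative, so moments are computed as expectations in the extended
    reals, where additivity and monotone convergence need no integrability. For this reason the
    mixed moments E[N_u N_v] and E[X_u X_v] are propagated instead of covariances, and a subtraction
    of expectations is replaced by adding a finite term to both sides. Independence is always used
    in one form: a variable is measurable for the sigma-algebra generated by a block of independent
    families, and disjoint blocks generate independent sigma-algebras. A thinning and a compound
    claim are both sums of random length, with Bernoulli variables or claim amounts as increments,
    so one computation of weighted first moments and of second moments serves for both. The counts
    are known only in law, and the root used by their representation need not be the centre of the
    ball. Their moments are therefore computed on the space carrying the representation, then
    transferred through the joint mass function. *)

Lemma measurable_fun_select d d' (T : measurableType d) (U : measurableType d')
    (K : T -> nat) (F : nat -> T -> U) :
  measurable_fun setT K -> (forall k, measurable_fun setT (F k)) ->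
  measurable_fun setT (fun w => F (K w) w).
Proof.
move=> mK mF _ Y mY; rewrite setTI.
rewrite (_ : _ @^-1` Y = \bigcup_k (K @^-1` [set k] `&` F k @^-1` Y)).
  apply: bigcupT_measurable => k; apply: measurableI.
    by rewrite -[X in measurable X]setTI; exact: mK.
  by rewrite -[X in measurable X]setTI; exact: mF.
apply/seteqP; split => [w Yw|w [k _ [/= <-]]] //=.
by exists (K w).
Qed.

Lemma measurable_fun_natr d (T : measurableType d) (R : realType) (K : T -> nat) :
  measurable_fun setT K -> measurable_fun setT (fun w => (K w)%:R : R).
Proof.
by move=> mK; exact: (@measurable_fun_select _ _ _ _ _ (fun k _ => k%:R : R)).
Qed.

Lemma measurable_compound d (T : measurableType d) (R : realType)
    (K : T -> nat) (Z : nat -> T -> R) :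
  measurable_fun setT K -> (forall j, measurable_fun setT (Z j)) ->
  measurable_fun setT (compound K Z).
Proof.
move=> mK mZ.
apply: (@measurable_fun_select _ _ _ _ _ (fun k w => \sum_(j < k) Z j w)) => //.
move=> k; exact: measurable_sum.
Qed.

Lemma sub_measurable_fun d d' (T : measurableType d) (U : measurableType d')
    (G : set (set T)) (X : T -> U) :
  G `<=` measurable ->
  measurable_fun [set: g_sigma_algebraType G] (X : g_sigma_algebraType G -> U) ->
  measurable_fun setT X.
Proof.
move=> Gm mX _ Y mY.
apply: (smallest_sub (@sigma_algebra_measurable _ T) Gm).
exact: mX.
Qed.

Lemma measurable_fun_g_sigmaS d d' (T : measurableType d) (U : measurableType d')
    (G H : set (set T)) (X : T -> U) :
  G `<=` H ->
  measurable_fun [set: g_sigma_algebraType G] (X : g_sigma_algebraType G -> U) ->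
  measurable_fun [set: g_sigma_algebraType H] (X : g_sigma_algebraType H -> U).
Proof. by move=> GH mX _ Y mY; apply: sub_smallest2r (mX _ _ _). Qed.

Section IndependentClasses.
Context {d : measure_display} {T : measurableType d} {R : realType}.
Variable P : probability T R.

Definition indep_classes (G H : set (set T)) : Prop :=
  forall A B, G A -> H B -> P (A `&` B) = (P A * P B)%E.

Lemma indep_classesC G H : indep_classes G H -> indep_classes H G.
Proof. by move=> GH A B HA GB; rewrite setIC GH// muleC. Qed.

(** For a fixed [B] in [H], the finite measures A |-> P (A [&] B) and P B times P agree on the
    pi-system [G], hence on the sigma-algebra it generates. *)
Lemma indep_classes_sigmal (G H : set (set T)) :
  G `<=` measurable -> H `<=` measurable -> setI_closed G -> G setT ->
  indep_classes G H -> indep_classes <<s G >> H.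
Proof.
move=> Gm Hm GI GT GH A B sA HB.
have mB := Hm _ HB.
have PB : P B \is a fin_num by exact: fin_num_measure.
have r0 : (0 <= fine (P B))%R by exact: fine_ge0.
rewrite [RHS]muleC -(fineK PB).
apply: (@g_sigma_algebra_measure_unique _ R T G Gm (fun=> setT) _ _
  (mrestr P mB) (mscale (NngNum r0) P)) => //.
- by rewrite bigcup_const.
- move=> E GE; rewrite /= /mrestr /mscale/= fineK// muleC.
  exact: GH.
- move=> _; by rewrite /= /mrestr setTI ltey_eq PB.
Qed.

Lemma indep_classes_sigma (G H : set (set T)) :
  G `<=` measurable -> H `<=` measurable -> setI_closed G -> G setT ->
  setI_closed H -> H setT ->
  indep_classes G H -> indep_classes <<s G >> <<s H >>.
Proof.
move=> Gm Hm GI GT HI HT GH.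
apply: indep_classes_sigmal => //.
  exact: (smallest_sub (@sigma_algebra_measurable _ T) Hm).
apply: indep_classesC; apply: indep_classes_sigmal => //.
exact: indep_classesC.
Qed.

(** Independence says that the joint law agrees with the product of the marginal laws on rectangles,
    hence everywhere; Tonelli's theorem then separates the two integrals. *)
Lemma indep_ge0_integralM d1 d2 (U1 : measurableType d1) (U2 : measurableType d2)
    (X : {RV P >-> U1}) (Y : {RV P >-> U2}) (f : U1 -> \bar R) (g : U2 -> \bar R) :
  measurable_fun setT f -> measurable_fun setT g ->
  (forall x, 0 <= f x)%E -> (forall y, 0 <= g y)%E ->
  indep_classes (sigma_rv X) (sigma_rv Y) ->
  (\int[P]_w (f (X w) * g (Y w)) = \int[P]_w f (X w) * \int[P]_w g (Y w))%E.
Proof.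
move=> mf mg f0 g0 XY.
have mXY : measurable_fun setT (fun w => (X w, Y w)) by exact: measurable_fun_pair.
pose XY' : {RV P >-> (U1 * U2)%type} := mfun_Sub (mem_set mXY).
pose h (z : U1 * U2) : \bar R := (f z.1 * g z.2)%E.
have mh : measurable_fun setT h.
  by apply: emeasurable_funM; exact: measurableT_comp.
have h0 z : (0 <= h z)%E by exact: mule_ge0.
have XY'E A : measurable A ->
    (distribution P X \x distribution P Y)%E A = distribution P XY' A.
  apply: product_measure_unique => // A1 A2 mA1 mA2.
  rewrite /= /distribution /pushforward /=.
  by apply: XY; [exists A1 => //|exists A2 => //]; exact: setTI.
transitivity (\int[distribution P XY']_z h z)%E.
  by rewrite ge0_integral_distribution.
rewrite (eq_measure_integral (distribution P X \x distribution P Y)%E); last first.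
  by move=> A mA _; exact/esym/XY'E.
rewrite fubini_tonelli1// /fubini_F /h/=.
under eq_integral.
  move=> x _; rewrite ge0_integralZl// ge0_integral_distribution//; over.
rewrite ge0_integralZr//; last first.
  by apply: integral_ge0 => y _; exact: g0.
by rewrite ge0_integral_distribution.
Qed.

Lemma indep_expectationM (X Y : T -> R) :
  measurable_fun setT X -> measurable_fun setT Y ->
  (forall w, 0 <= X w) -> (forall w, 0 <= Y w) ->
  indep_classes (sigma_rv X) (sigma_rv Y) ->
  ('E_P[fun w => (X w * Y w)%R] = 'E_P[X] * 'E_P[Y])%E.
Proof.
move=> mX mY X0 Y0 XY; rewrite !unlock.
(* [X] and [Y] are nonnegative, but the identity on R is not: the absolute value is a test function
   that is nonnegative everywhere and has the same composite. *)
have ae (Z : T -> R) : (forall w, 0 <= Z w) ->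
    (\int[P]_w (Z w)%:E = \int[P]_w `|Z w|%:E)%E.
  by move=> Z0; apply: eq_integral => w _; rewrite ger0_norm.
rewrite (ae X)// (ae Y)// -(@indep_ge0_integralM _ _ _ _ (mfun_Sub (mem_set mX))
  (mfun_Sub (mem_set mY)) (fun x => `|x|%:E) (fun x => `|x|%:E))//.
- by apply: eq_integral => w _ /=; rewrite !ger0_norm.
- by apply/measurable_EFinP; exact: normr_measurable.
- by apply/measurable_EFinP; exact: normr_measurable.
Qed.

Lemma indep_g_sigma_expectationM (G H : set (set T)) (X Y : T -> R) :
  G `<=` measurable -> H `<=` measurable ->
  indep_classes <<s G >> <<s H >> ->
  measurable_fun [set: g_sigma_algebraType G] (X : g_sigma_algebraType G -> R) ->
  measurable_fun [set: g_sigma_algebraType H] (Y : g_sigma_algebraType H -> R) ->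
  (forall w, 0 <= X w) -> (forall w, 0 <= Y w) ->
  ('E_P[fun w => (X w * Y w)%R] = 'E_P[X] * 'E_P[Y])%E.
Proof.
move=> Gm Hm GH mX mY X0 Y0; apply: indep_expectationM => //.
- exact: sub_measurable_fun mX.
- exact: sub_measurable_fun mY.
- by move=> A B [A' mA' <-] [B' mB' <-]; apply: GH; [exact: mX|exact: mY].
Qed.

End IndependentClasses.

Section IndependentGroups.
Context {d : measure_display} {T : measurableType d} {R : realType}.
Context {I : choiceType}.
Variables (P : probability T R) (D : set I) (F : I -> set (set T)).
Hypothesis indF : independent P D F.
Hypothesis FT : forall i, D i -> F i setT.
Hypothesis FI : forall i, D i -> setI_closed (F i).
Hypothesis Fm : forall i, D i -> F i `<=` measurable.

Definition class_group (J : set I) : set (set T) := \bigcup_(i in D `&` J) F i.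

(** The union [class_group J] is in general not stable under intersection. These finite
    intersections, with one event per index, form a pi-system containing it, to which mutual
    independence applies directly. *)
Definition finite_meets (J : set I) : set (set T) :=
  [set A | exists (K : {fset I}) (E : I -> set T),
     (forall i, i \in K -> (D i /\ J i) /\ F i (E i)) /\
     A = \bigcap_(i in [set` K]) E i].

Lemma sub_class_group (J J' : set I) : J `<=` J' -> class_group J `<=` class_group J'.
Proof. by move=> JJ' A [i [Di Ji] FA]; exists i => //; split => //; exact: JJ'. Qed.

Lemma class_group_measurable (J : set I) : class_group J `<=` measurable.
Proof. by move=> A [i [Di _] FA]; exact: Fm FA. Qed.

Lemma sub_finite_meets (J : set I) : class_group J `<=` finite_meets J.
Proof.
move=> A [i [Di Ji] FA]; exists [fset i]%fset, (fun=> A); split.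
  by move=> j /fset1P ->.
by rewrite set_fset1 bigcap_set1.
Qed.

Lemma finite_meets_measurable (J : set I) : finite_meets J `<=` measurable.
Proof.
move=> _ [K [E [KE ->]]]; apply: fin_bigcap_measurable.
  exact: finite_fset.
by move=> i Ki; have [[Di _]] := KE _ Ki; exact: Fm.
Qed.

Lemma finite_meetsT (J : set I) : finite_meets J setT.
Proof. by exists fset0, (fun=> setT); split => //; rewrite set_fset0 bigcap_set0. Qed.

Lemma finite_meetsI (J : set I) : setI_closed (finite_meets J).
Proof.
move=> _ _ [K1 [E1 [KE1 ->]]] [K2 [E2 [KE2 ->]]].
(* An index missing from one of the two families is padded with the full event. *)
exists (K1 `|` K2)%fset, (fun i => (if i \in K1 then E1 i else setT) `&`
  (if i \in K2 then E2 i else setT)); split.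
  move=> i; rewrite inE => iK.
  have DJ : D i /\ J i by case/orP : iK => [/KE1[]|/KE2[]].
  split => //; apply: FI; first by case: DJ.
  - by case: ifPn => [/KE1[]//|_]; apply: FT; case: DJ.
  - by case: ifPn => [/KE2[]//|_]; apply: FT; case: DJ.
apply/seteqP; split => [w [E1w E2w] i /= _|w Ew].
  split; first by case: ifPn => // ?; exact: E1w.
  by case: ifPn => // ?; exact: E2w.
split=> i /= iK.
  by have := Ew i; rewrite /= inE iK => /(_ isT)[].
by have := Ew i; rewrite /= inE iK orbT => /(_ isT)[].
Qed.

Lemma indep_finite_meets (J1 J2 : set I) : J1 `&` J2 = set0 ->
  indep_classes P (finite_meets J1) (finite_meets J2).
Proof.
move=> J12 _ _ [K1 [E1 [KE1 ->]]] [K2 [E2 [KE2 ->]]].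
have dis i : i \in K2 -> i \in K1 = false.
  move=> iK2; apply/negP => iK1; have [[_ ?] _] := KE1 _ iK1.
  have [[_ ?] _] := KE2 _ iK2.
  by have : (J1 `&` J2) i by []; rewrite J12.
pose E i := if i \in K1 then E1 i else E2 i.
have -> : \bigcap_(i in [set` K1]) E1 i `&` \bigcap_(i in [set` K2]) E2 i =
    \bigcap_(i in [set` (K1 `|` K2)%fset]) E i.
  apply/seteqP; split => [w [E1w E2w] i /=|w Ew].
    rewrite inE /E; case: ifPn => [iK1 _|_ /= iK2]; first exact: E1w.
    exact: E2w.
  split=> i /= iK.
    by have := Ew i; rewrite /= inE /E iK; apply.
  by have := Ew i; rewrite /= inE /E iK dis//; apply.
rewrite indF; last first.
  move=> i; rewrite inE /E; case: ifPn => [/KE1[[]]//|_ /= /KE2[[]]//].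
rewrite indF; last by move=> i /KE1[[]].
rewrite indF; last by move=> i /KE2[[]].
rewrite (perm_big (K1 ++ K2)) /=; last first.
  apply: uniq_perm; first exact: fset_uniq.
    rewrite cat_uniq !fset_uniq andbT /=; apply/hasPn => i /=.
    by move=> /dis ->.
  by move=> i; rewrite mem_cat inE.
rewrite big_cat/=; congr (_ * _)%E.
  by apply: eq_big_seq => i iK; rewrite /E iK.
by apply: eq_big_seq => i iK; rewrite /E dis.
Qed.

(** Grouping principle, through the pi-systems of finite meets. It applies to the noises of the
    tree, to the count vector against the claim sequences, and to the claims of a single
    sequence. *)
Lemma indep_class_group (J1 J2 : set I) : J1 `&` J2 = set0 ->
  indep_classes P <<s class_group J1 >> <<s class_group J2 >>.
Proof.
move=> J12 A B sA sB.
have := indep_classes_sigma (@finite_meets_measurable J1)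
  (@finite_meets_measurable J2) (@finite_meetsI J1) (@finite_meetsT J1)
  (@finite_meetsI J2) (@finite_meetsT J2) (indep_finite_meets J12).
apply; [move: A sA|move: B sB]; apply: sub_smallest2r; try exact: smallest_sigma_algebra;
  exact: sub_finite_meets.
Qed.

Lemma class_group_rv d' (U : measurableType d') (X : T -> U) (J : set I) (i : I) :
  D i -> J i -> sigma_rv X `<=` F i ->
  measurable_fun [set: g_sigma_algebraType (class_group J)]
    (X : g_sigma_algebraType (class_group J) -> U).
Proof.
move=> Di Ji XF _ Y mY; apply: sub_sigma_algebra.
by exists i => //; apply: XF; exists Y.
Qed.

End IndependentGroups.

Lemma sigma_rvT d d' (T : measurableType d) (U : measurableType d') (X : T -> U) :
  sigma_rv X setT.
Proof. by exists setT => //; rewrite setTI preimage_setT. Qed.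

Lemma sigma_rvI d d' (T : measurableType d) (U : measurableType d') (X : T -> U) :
  setI_closed (sigma_rv X).
Proof.
move=> _ _ [A mA <-] [B mB <-]; exists (A `&` B); first exact: measurableI.
by rewrite !setTI preimage_setI.
Qed.

Lemma sigma_rv_measurable d d' (T : measurableType d) (U : measurableType d')
    (X : T -> U) :
  measurable_fun setT X -> sigma_rv X `<=` measurable.
Proof. by move=> mX _ [A mA <-]; exact: mX. Qed.

(** * Linearity of the expectation for nonnegative variables *)

Section GeZeroExpectation.
Context {d : measure_display} {T : measurableType d} {R : realType}.
Variable P : probability T R.
Local Open Scope ereal_scope.

Lemma ge0_expectationZl (k : R) (X : T -> R) : measurable_fun setT X ->
  (forall w, 0 <= X w)%R -> (0 <= k)%R ->
  'E_P[fun w => (k * X w)%R] = k%:E * 'E_P[X].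
Proof.
move=> mX X0 k0; rewrite !unlock -ge0_integralZl//; first exact/measurable_EFinP.
by move=> w _; rewrite lee_fin.
Qed.

Lemma ge0_expectationD (X Y : T -> R) :
  measurable_fun setT X -> measurable_fun setT Y ->
  (forall w, 0 <= X w)%R -> (forall w, 0 <= Y w)%R ->
  'E_P[fun w => (X w + Y w)%R] = 'E_P[X] + 'E_P[Y].
Proof.
move=> mX mY X0 Y0; rewrite !unlock -ge0_integralD//.
- by move=> w _; rewrite lee_fin.
- exact/measurable_EFinP.
- by move=> w _; rewrite lee_fin.
- exact/measurable_EFinP.
Qed.

Lemma ge0_expectation_sum (I : Type) (s : seq I) (X : I -> T -> R) :
  (forall i, measurable_fun setT (X i)) -> (forall i w, 0 <= X i w)%R ->
  'E_P[fun w => (\sum_(i <- s) X i w)%R] = \sum_(i <- s) 'E_P[X i].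
Proof.
move=> mX X0; elim: s => [|i s ih].
  under [X in 'E_P[X]]eq_fun do rewrite big_nil.
  by rewrite big_nil (expectation_cst P 0%R).
under [X in 'E_P[X]]eq_fun do rewrite big_cons.
rewrite big_cons (ge0_expectationD (mX i)) ?ih//; first exact: measurable_sum.
by move=> w; exact: sumr_ge0.
Qed.

End GeZeroExpectation.

(** * Moments of compound sums *)

(** Moves the number of terms from the range of the sum into an indicator, so that a sum of random
    length becomes a series that can be integrated term by term. *)
Lemma sum_ord_nneseries (R : realType) (V : nat -> R) (k : nat) :
  (forall j, 0 <= V j) ->
  ((\sum_(j < k) V j)%:E = \sum_(0 <= j <oo) ((j < k)%N%:R * V j)%:E)%E.
Proof.
move=> V0; rewrite (@nneseries_split R _ 0 k); last first.
  by move=> j _; rewrite lee_fin mulr_ge0.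
rewrite add0n [X in (_ + X)%E]eseries0 ?adde0; last first.
  by move=> j kj _; rewrite ltnNge kj mul0r.
rewrite big_mkord sumEFin; congr EFin.
by apply: eq_bigr => j _; rewrite ltn_ord mul1r.
Qed.

Section Compound.
Context {d : measure_display} {T : measurableType d} {R : realType}.
Variable P : probability T R.

Lemma expectation_select_sum (K : T -> nat) (V : nat -> T -> R) (Y : T -> R) :
  measurable_fun setT K -> (forall j, measurable_fun setT (V j)) ->
  measurable_fun setT Y -> (forall j w, 0 <= V j w) -> (forall w, 0 <= Y w) ->
  ('E_P[fun w => ((\sum_(j < K w) V j w) * Y w)%R] =
   \sum_(0 <= j <oo) 'E_P[fun w => ((j < K w)%N%:R * Y w * V j w)%R])%E.
Proof.
move=> mK mV mY V0 Y0; rewrite unlock -integral_nneseries//.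
- apply: eq_integral => w _; rewrite mulr_suml.
  rewrite (sum_ord_nneseries (V := fun j => V j w * Y w)) => [|j]; last exact: mulr_ge0.
  by apply: eq_eseriesr => j _; rewrite -mulrA [Y w * _]mulrC.
- move=> j; apply/measurable_EFinP; apply: measurable_funM => //.
  apply: measurable_funM => //.
  exact: (@measurable_fun_select _ _ _ _ K (fun k _ => (j < k)%N%:R : R)).
- by move=> j w _; rewrite lee_fin !mulr_ge0.
Qed.

(** A weighted form of Wald's identity: if each increment factors from the event that it is counted,
    it may be replaced by its mean inside the sum. *)
Lemma eq_expectation_select_sum (K : T -> nat) (U : nat -> T -> R) (Y : T -> R)
    (c : nat -> R) :
  measurable_fun setT K -> (forall j, measurable_fun setT (U j)) ->
  measurable_fun setT Y -> (forall j w, 0 <= U j w) -> (forall w, 0 <= Y w) ->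
  (forall j, 0 <= c j) ->
  (forall j, 'E_P[fun w => ((j < K w)%N%:R * Y w * U j w)%R] =
     'E_P[fun w => ((j < K w)%N%:R * Y w)%R] * (c j)%:E)%E ->
  ('E_P[fun w => ((\sum_(j < K w) U j w) * Y w)%R] =
   'E_P[fun w => ((\sum_(j < K w) c j) * Y w)%R])%E.
Proof.
move=> mK mU mY U0 Y0 c0 Uc.
rewrite !(expectation_select_sum (V := fun j _ => c j)) ?expectation_select_sum//.
apply: eq_eseriesr => j _; rewrite Uc muleC -ge0_expectationZl//.
- by congr ('E_P[_])%E; apply/funext => w; rewrite mulrC.
- apply: measurable_funM => //.
  exact: (@measurable_fun_select _ _ _ _ K (fun k _ => (j < k)%N%:R : R)).
- by move=> w; rewrite mulr_ge0.
Qed.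

Variables G H : set (set T).
Hypotheses (Gm : G `<=` measurable) (Hm : H `<=` measurable).
Hypothesis GH : indep_classes P <<s G >> <<s H >>.
Variables (K : T -> nat) (Z : nat -> T -> R).
Hypothesis GK :
  measurable_fun [set: g_sigma_algebraType G] (K : g_sigma_algebraType G -> nat).
Hypothesis HZ : forall j,
  measurable_fun [set: g_sigma_algebraType H] (Z j : g_sigma_algebraType H -> R).
Hypothesis Z0 : forall j w, 0 <= Z j w.
Variable m : R.
Hypothesis Zm : forall j, ('E_P[Z j] = m%:E)%E.

Let m_ge0 : 0 <= m.
Proof. by rewrite -lee_fin -(Zm 0); exact: expectation_ge0. Qed.

Let GltK (j : nat) : measurable_fun [set: g_sigma_algebraType G]
  ((fun w => (j < K w)%N%:R) : g_sigma_algebraType G -> R).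
Proof.
by apply: (@measurable_fun_select _ _ (g_sigma_algebraType G) _ K
  (fun k _ => (j < k)%N%:R : R)).
Qed.

(** Each [Z j] is independent of the pair made of the event j < K and the weight [Y]. The weight is
    what yields mixed moments: it is later another count, another claim total or a Poisson term. *)
Lemma expectation_compoundM (Y : T -> R) :
  measurable_fun [set: g_sigma_algebraType G] (Y : g_sigma_algebraType G -> R) ->
  (forall w, 0 <= Y w) ->
  ('E_P[fun w => (compound K Z w * Y w)%R] =
   m%:E * 'E_P[fun w => ((K w)%:R * Y w)%R])%E.
Proof.
move=> GY Y0.
have mK := sub_measurable_fun Gm GK; have mY := sub_measurable_fun Gm GY.
rewrite (@eq_expectation_select_sum K Z Y (fun=> m))//.
- rewrite -ge0_expectationZl//.
  + congr ('E_P[_])%E; apply/funext => w.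
    by rewrite sumr_const card_ord -[m *+ _]mulr_natl; ring.
  + by apply: measurable_funM => //; exact: measurable_fun_natr.
  + by move=> w; rewrite mulr_ge0.
- by move=> j; exact: sub_measurable_fun (HZ j).
- move=> j; rewrite -(Zm j).
  apply: (indep_g_sigma_expectationM Gm Hm) => //.
  + exact: measurable_funM.
  + by move=> w; rewrite mulr_ge0.
Qed.

Lemma expectation_compound :
  ('E_P[compound K Z] = m%:E * 'E_P[fun w => (K w)%:R : R])%E.
Proof.
have := @expectation_compoundM (fun=> 1) (measurable_cst _) (fun=> ler01).
under [X in ('E_P[X])%E]eq_fun do rewrite mulr1.
by under [X in (_ = _ * 'E_P[X])%E -> _]eq_fun do rewrite mulr1.
Qed.

Variables s k1 k2 : R.
Hypothesis Zs : forall j, ('E_P[fun w => (Z j w ^+ 2)%R] = s%:E)%E.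
Hypothesis Zij : forall i j : nat, i != j ->
  ('E_P[fun w => (Z i w * Z j w)%R] = (m ^+ 2)%:E)%E.
Hypothesis Kk1 : ('E_P[fun w => (K w)%:R : R] = k1%:E)%E.
Hypothesis Kk2 : ('E_P[fun w => ((K w)%:R ^+ 2)%R : R] = k2%:E)%E.

(* The square of the partial sum is itself a partial sum, with increments
   [Z j ^ 2 + 2 * Z j * (Z 0 + ... + Z (j - 1))]. *)
Lemma expectation_compound_sqr :
  ('E_P[fun w => (compound K Z w ^+ 2)%R] = (m ^+ 2 * (k2 - k1) + s * k1)%:E)%E.
Proof.
have mK := sub_measurable_fun Gm GK.
have mKR := @measurable_fun_natr _ _ R _ mK.
have mZ j := sub_measurable_fun Hm (HZ j).
pose U j w := Z j w ^+ 2 + 2 * (\sum_(i < j) Z i w * Z j w).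
(* The mean of [U j]: one square of mean [s] and [j] cross products of mean [m ^+ 2], counted
   twice. *)
pose c j := s + 2 * j%:R * m ^+ 2.
have s0 : 0 <= s by rewrite -lee_fin -(Zs 0); apply: expectation_ge0 => w; exact: sqr_ge0.
have c0 j : 0 <= c j by rewrite addr_ge0// !mulr_ge0// sqr_ge0.
have U0 j w : 0 <= U j w.
  by rewrite addr_ge0 ?sqr_ge0// mulr_ge0// sumr_ge0// => i _; rewrite mulr_ge0.
have HU j : measurable_fun [set: g_sigma_algebraType H]
    (U j : g_sigma_algebraType H -> R).
  apply: measurable_funD; first exact: measurable_funX.
  apply: measurable_funM => //; apply: measurable_sum => i; exact: measurable_funM.
have sqrE w : compound K Z w ^+ 2 = (\sum_(j < K w) U j w) * 1.
  rewrite mulr1 /compound; elim: (K w) => [|k ih]; first by rewrite !big_ord0 expr0n.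
  by rewrite !big_ord_recr/= sqrrD ih /U -mulr_suml; ring.
under [X in ('E_P[X])%E]eq_fun do rewrite sqrE.
rewrite (@eq_expectation_select_sum K U (fun=> 1) c)//; first last.
- move=> j; under [X in ('E_P[X])%E]eq_fun do rewrite mulr1.
  under [X in (_ = 'E_P[X] * _)%E]eq_fun do rewrite mulr1.
  rewrite (indep_g_sigma_expectationM Gm Hm GH)//; congr (_ * _)%E.
  rewrite ge0_expectationD//; first last.
  - by move=> w; rewrite mulr_ge0// sumr_ge0// => i _; rewrite mulr_ge0.
  - by move=> w; exact: sqr_ge0.
  - apply: measurable_funM => //; apply: measurable_sum => i; exact: measurable_funM.
  - exact: measurable_funX.
  rewrite Zs ge0_expectationZl//; first last.
  - by move=> w; rewrite sumr_ge0// => i _; rewrite mulr_ge0.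
  - by apply: measurable_sum => i; exact: measurable_funM.
  rewrite (@ge0_expectation_sum _ _ _ _ _ _ (fun (i : 'I_j) w => Z i w * Z j w)); first last.
  - by move=> i w; rewrite mulr_ge0.
  - by move=> i; exact: measurable_funM.
  rewrite (eq_bigr (fun=> (m ^+ 2)%:E)); last first.
    by move=> i _; apply: Zij; rewrite neq_ltn ltn_ord.
  rewrite sumEFin -EFinM -EFinD; congr EFin.
  by rewrite sumr_const card_ord /c -[_ *+ j]mulr_natl; ring.
- by move=> j; exact: sub_measurable_fun (HU j).
have sumcE k : (\sum_(j < k) c j) * 1 =
    s * k%:R + m ^+ 2 * (k%:R ^+ 2 - k%:R).
  rewrite mulr1; elim: k => [|k ih]; first by rewrite big_ord0; ring.
  by rewrite big_ord_recr/= ih /c -natr1; ring.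
under [X in ('E_P[X])%E]eq_fun do rewrite sumcE.
have KK0 w : 0 <= (K w)%:R ^+ 2 - (K w)%:R :> R.
  by rewrite subr_ge0 -natrX ler_nat -mulnn; case: (K w) => // k; exact: leq_pmulr.
have mKK : measurable_fun setT (fun w => (K w)%:R ^+ 2 - (K w)%:R : R).
  by apply: measurable_funB => //; exact: measurable_funX.
(* K ^ 2 - K is nonnegative since [K] is integer-valued, so additivity applies after adding [K]
   back, and its finite mean can be cancelled. *)
have EKK : ('E_P[fun w => ((K w)%:R ^+ 2 - (K w)%:R)%R : R] = (k2 - k1)%:E)%E.
  have : ('E_P[fun w => ((K w)%:R ^+ 2 - (K w)%:R + (K w)%:R)%R : R] = k2%:E)%E.
    by rewrite -Kk2; congr ('E_P[_])%E; apply/funext => w; rewrite subrK.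
  rewrite ge0_expectationD// Kk1 EFinB => <-.
  by rewrite addeK.
rewrite ge0_expectationD//; first last.
- by move=> w; rewrite mulr_ge0// sqr_ge0.
- by move=> w; rewrite mulr_ge0.
- by apply: measurable_funM.
- by apply: measurable_funM.
rewrite !ge0_expectationZl// ?sqr_ge0// Kk1 EKK -!EFinM -EFinD.
by congr EFin; ring.
Qed.

End Compound.

(** * Poisson and Bernoulli moments *)

Section DiscreteExpectation.
Context {d : measure_display} {T : measurableType d} {R : realType}.
Variable P : probability T R.

Lemma ge0_expectation_nat (L : T -> nat) (h : nat -> R) :
  measurable_fun setT L -> (forall k, 0 <= h k) ->
  ('E_P[h \o L] = \sum_(0 <= k <oo) (h k)%:E * P (L @^-1` [set k]))%E.
Proof.
move=> mL h0; rewrite unlock.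
have mLk k : measurable (L @^-1` [set k]).
  by rewrite -[X in measurable X]setTI; exact: mL.
transitivity (\int[P]_w \sum_(0 <= k <oo) ((h k)%:E * (\1_(L @^-1` [set k]) w)%:E))%E.
  apply: eq_integral => w _.
  rewrite (nneseriesD1 (n := L w))//; last first.
    by move=> k _; rewrite mule_ge0 ?lee_fin.
  rewrite indicE mem_set// mule1 eseries0 ?adde0// => k _ /= kL.
  by rewrite indicE memNset ?mule0// => /= Lk; rewrite Lk eqxx in kL.
rewrite integral_nneseries//; last 2 first.
- move=> k; apply: emeasurable_funM => //; apply/measurable_EFinP.
  exact: measurable_indic.
- by move=> k w _; rewrite mule_ge0 ?lee_fin.
apply: eq_eseriesr => k _.
rewrite ge0_integralZl// ?integral_indic ?setIT ?lee_fin//.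
by apply/measurable_EFinP; exact: measurable_indic.
Qed.

Variables (L : {RV P >-> nat}) (rate : R).
Hypothesis rate0 : 0 <= rate.
Hypothesis Lrate :
  distribution P L = poisson_prob rate 0 :> (set nat -> \bar R).

Lemma poisson_recurrence (k : nat) :
  (k.+1%:R%:E * P (L @^-1` [set k.+1]) = rate%:E * P (L @^-1` [set k]))%E.
Proof.
have E n : P (L @^-1` [set n]) = poisson_prob rate 0 [set n] by rewrite -Lrate.
rewrite !E /poisson_prob; case: ifPn => [r0|].
  rewrite !esum_set1 ?lee_fin ?poisson_pmf_ge0// /poisson_pmf r0 -!EFinM; congr EFin.
  rewrite factS natrM exprS; field.
  by rewrite addrC natr1 pnatr_eq0/= pnatr_eq0 -lt0n fact_gt0.
(* At rate 0 the law is the point mass at 0, which gives no mass to a successor. *)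
rewrite -leNgt => r0; have -> : rate = 0 by apply/le_anti; rewrite r0 rate0.
by rewrite mul0e !diracE memNset ?mule0.
Qed.

(** The Chen-Stein identity: the recurrence between consecutive masses, weighted by [h] and summed
    with a shift of the index. Taking [h] equal to 1 and to k + 1 gives the first two moments
    without evaluating any exponential series. *)
Lemma poisson_chen_stein (h : nat -> R) : (forall k, 0 <= h k) ->
  ('E_P[fun w => ((L w)%:R * h (L w).-1)%R] = rate%:E * 'E_P[h \o L])%E.
Proof.
move=> h0.
rewrite (ge0_expectation_nat (h := fun k => k%:R * h k.-1))//; last first.
  by move=> k; rewrite mulr_ge0.
rewrite ge0_expectation_nat// nneseries_recl//; last first.
  by move=> k _; rewrite mule_ge0// lee_fin mulr_ge0.
rewrite mul0r mul0e add0e -nneseriesZl; last first.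
  by move=> k _; rewrite mule_ge0// lee_fin.
rewrite -nneseries_addn; last first.
  by move=> k; rewrite mule_ge0// lee_fin mulr_ge0.
apply: eq_eseriesr => k _; rewrite addn1 /= muleCA -poisson_recurrence EFinM.
by rewrite -muleA muleCA.
Qed.

Lemma expectation_poisson : ('E_P[fun w => (L w)%:R : R] = rate%:E)%E.
Proof.
have := @poisson_chen_stein (fun=> 1) (fun=> ler01).
rewrite (expectation_cst P 1%R) mule1 => <-.
by under [X in (_ = 'E_P[X])%E]eq_fun do rewrite mulr1.
Qed.

Lemma expectation_poisson_sqr :
  ('E_P[fun w => ((L w)%:R ^+ 2)%R : R] = (rate + rate ^+ 2)%:E)%E.
Proof.
have := @poisson_chen_stein (fun k => k.+1%:R) (fun=> ler0n _ _).
rewrite (_ : _ \o _ = fun w => 1 + (L w)%:R); last first.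
  by apply/funext => w /=; rewrite addrC natr1.
rewrite ge0_expectationD//; last exact: measurable_fun_natr.
rewrite (expectation_cst P 1%R) expectation_poisson -EFinD -EFinM mulrDr mulr1.
rewrite -expr2 => <-; congr ('E_P[_])%E; apply/funext => w.
by rewrite expr2; case: (L w) => [|k]; rewrite ?mul0r.
Qed.

End DiscreteExpectation.

Lemma expectation_bernoulli d (T : measurableType d) (R : realType)
    (P : probability T R) (X : {RV P >-> bool}) (p : R) : 0 <= p <= 1 ->
  distribution P X = bernoulli_prob p :> (set bool -> \bar R) ->
  ('E_P[fun w => (X w)%:R : R] = p%:E)%E.
Proof.
move=> p01 Xp.
have mX : measurable (X @^-1` [set true]).
  by rewrite -[X in measurable X]setTI; exact: measurable_funPT.
rewrite (_ : (fun w => _) = \1_(X @^-1` [set true])); last first.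
  apply/funext => w; rewrite indicE.
  by case E : (X w); [rewrite mem_set|rewrite memNset//= E].
rewrite expectation_indic// -[LHS]/(distribution P X [set true]) Xp.
by rewrite bernoulli_probE// !diracE mem_set// memNset// mule1 mule0 adde0.
Qed.

(** * Moments of the MPMRF *)

Lemma measurable_natr_bool d (T : measurableType d) (R : realType) (X : T -> bool) :
  measurable_fun setT X -> measurable_fun setT (fun w => (X w)%:R : R).
Proof.
by move=> mX; apply: (@measurableT_comp _ _ _ _ _ _ (fun b : bool => b%:R : R)).
Qed.

Lemma measurable_thinning d (T : measurableType d) (I : nat -> T -> bool)
    (Y : T -> nat) :
  (forall j, measurable_fun setT (I j)) -> measurable_fun setT Y ->
  measurable_fun setT (thinning I Y).
Proof.
move=> mI mY.
apply: (@measurable_fun_select _ _ _ _ Y (fun k w => \sum_(j < k) I j w)%N) => // k.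
elim: k => [|k ih].
  by under eq_fun do rewrite big_ord0; exact: measurable_cst.
under eq_fun do rewrite big_ord_recr/=.
apply: measurable_fun_addn => //.
exact: (@measurableT_comp _ _ _ _ _ _ nat_of_bool).
Qed.

Lemma natr_thinning (R : realType) (T : Type) (I : nat -> T -> bool) (Y : T -> nat)
    (w : T) :
  (thinning I Y w)%:R = compound Y (fun j w => (I j w)%:R : R) w.
Proof. by rewrite /thinning natr_sum. Qed.

(** Vertices are handled through their path from the root, so that removing the last element of the
    list is the passage from a vertex to its parent. *)
Definition branch (V : choiceType) (adj : rel V) (T : {fset V}) (r : V)
    (s : seq V) : Prop :=
  [/\ path adj r s, uniq (r :: s) & {subset r :: s <= T}].

Lemma branch_rcons (V : choiceType) (adj : rel V) (T : {fset V}) (r : V)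
    (s : seq V) (v : V) : branch adj T r (rcons s v) ->
  [/\ branch adj T r s, adj (last r s) v, v \notin r :: s, v \in T &
      parent adj T r (last r s) v].
Proof.
move=> [rsv usv sub].
have vrs : v \notin r :: s.
  by move: usv; rewrite -rcons_cons rcons_uniq => /andP[].
move: (rsv); rewrite rcons_path => /andP[rs sv].
split => //.
- split=> //.
    by move: usv; rewrite -rcons_cons rcons_uniq => /andP[].
  by move=> x xs; apply: sub; rewrite -rcons_cons mem_rcons in_cons xs orbT.
- by apply: sub; rewrite -rcons_cons mem_rcons mem_head.
- by exists s; split => //; split => //; rewrite last_rcons.
Qed.

Section MPMRFMoments.
Context {R : realType} {V : choiceType} {d : measure_display}
  {Omega : measurableType d}.
Variables (lam : V -> R) (alpha : V -> V -> R) (adj : rel V) (T : {fset V}).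
Variables (P : probability Omega R) (N : V -> Omega -> nat).
Variables (r : V) (L : V -> {RV P >-> nat}) (I : V -> nat -> {RV P >-> bool}).
Hypothesis adm : admissible adj lam alpha.
Hypothesis rT : r \in T.
Hypothesis indLI :
  independent P (noise_index T r) (noise_sigma L (fun v j => I v j)).
Hypothesis Lr : distribution P (L r) = poisson_prob (lam r) 0 :> (set nat -> \bar R).
Hypothesis NLr : N r =1 L r.
Hypothesis Nstep : forall p v : V, parent adj T r p v ->
  [/\ distribution P (L v) =
        poisson_prob (lam v * (1 - alpha p v * Num.sqrt (lam p / lam v))) 0
        :> (set nat -> \bar R),
      forall j, distribution P (I v j) =
        bernoulli_prob (alpha p v * Num.sqrt (lam v / lam p))
        :> (set bool -> \bar R) &
      forall w, N v w = (thinning (I v) (N p) w + L v w)%N].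

Let lam_gt0 v : 0 < lam v. Proof. by case: adm. Qed.

Let sqrt_lam_div u v : Num.sqrt (lam u / lam v) = Num.sqrt (lam u) / Num.sqrt (lam v).
Proof. by rewrite sqrtrM ?sqrtrV ?(ltW (lam_gt0 _)). Qed.

Definition noise_group : set (V + V * nat)%type -> set (set Omega) :=
  class_group (noise_index T r) (noise_sigma L (fun v j => I v j)).

Definition noise_at (S : seq V) : set (V + V * nat)%type :=
  [set i | match i with inl u => u \in S | inr (u, _) => u \in S end].

Let FT i : noise_index T r i -> noise_sigma L (fun v j => I v j) i setT.
Proof. by case: i => [v|[v j]] _; exact: sigma_rvT. Qed.

Let FI i : noise_index T r i -> setI_closed (noise_sigma L (fun v j => I v j) i).
Proof. by case: i => [v|[v j]] _; exact: sigma_rvI. Qed.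

Let Fm i : noise_index T r i -> noise_sigma L (fun v j => I v j) i `<=` measurable.
Proof. by case: i => [v|[v j]] _; exact: sigma_rv_measurable. Qed.

Let noise_measurable J : noise_group J `<=` measurable.
Proof. exact: class_group_measurable. Qed.

Let indep_noise J1 J2 : J1 `&` J2 = set0 ->
  indep_classes P <<s noise_group J1 >> <<s noise_group J2 >>.
Proof. exact: indep_class_group. Qed.

Let noise_measurableL J v : v \in T -> J (inl v) ->
  measurable_fun [set: g_sigma_algebraType (noise_group J)]
    ((fun w => (L v w)%:R) : g_sigma_algebraType (noise_group J) -> R).
Proof.
move=> vT Jv; apply: measurable_fun_natr.
exact: (class_group_rv (i := inl v)).
Qed.

Let noise_measurableI J v j : v \in T -> v != r -> J (inr (v, j)) ->
  measurable_fun [set: g_sigma_algebraType (noise_group J)]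
    ((fun w => (I v j w)%:R) : g_sigma_algebraType (noise_group J) -> R).
Proof.
move=> vT vr Jv; apply: measurable_natr_bool.
by apply: (class_group_rv (i := inr (v, j))) => //; apply/andP.
Qed.

(** Unrolling the recursion, the count at the end of a branch depends only on the noises attached to
    the vertices of that branch. Allowing any larger [J] lets the same count be placed in a block
    together with other variables. *)
Lemma branch_measurable s (J : set (V + V * nat)%type) : branch adj T r s ->
  noise_at (r :: s) `<=` J ->
  measurable_fun [set: g_sigma_algebraType (noise_group J)]
    (N (last r s) : g_sigma_algebraType (noise_group J) -> nat).
Proof.
elim/last_ind: s => [|s v ih] bs sJ.
  rewrite /= (_ : N r = L r); last exact/funext.
  by apply: (class_group_rv (i := inl r)) => //; apply: sJ; exact: mem_head.
have [bs' _ vrs vT pv] := branch_rcons bs.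
have [_ _ Nv] := Nstep pv.
have vr : v != r by apply: contraNneq vrs => ->; exact: mem_head.
rewrite last_rcons (_ : N v = fun w => (thinning (I v) (N (last r s)) w + L v w)%N);
  last exact/funext.
have vsv : v \in r :: rcons s v by rewrite -rcons_cons mem_rcons mem_head.
apply: measurable_fun_addn.
  apply: (@measurable_thinning _ (g_sigma_algebraType (noise_group J))).
    move=> j; apply: (class_group_rv (i := inr (v, j))) => //; first exact/andP.
    exact: sJ.
  apply: ih => //; apply: subset_trans sJ => -[u|[u j]] /= us;
    by rewrite /noise_at/= -rcons_cons mem_rcons in_cons us orbT.
by apply: (class_group_rv (i := inl v)) => //; exact: sJ.
Qed.

Section Step.
Variables (s : seq V) (v : V).
Hypothesis bsv : branch adj T r (rcons s v).
Let p := last r s.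
Let a := alpha p v * Num.sqrt (lam v / lam p).
Let l := lam v * (1 - alpha p v * Num.sqrt (lam p / lam v)).
Let Is : set (V + V * nat)%type := [set i | exists j, i = inr (v, j)].
Let Z (j : nat) (w : Omega) : R := (I v j w)%:R.

Let bs : branch adj T r s. Proof. by case: (branch_rcons bsv). Qed.
Let pv : adj p v. Proof. by case: (branch_rcons bsv). Qed.
Let vs : v \notin r :: s. Proof. by case: (branch_rcons bsv). Qed.
Let vT : v \in T. Proof. by case: (branch_rcons bsv). Qed.
Let ppv : parent adj T r p v. Proof. by case: (branch_rcons bsv). Qed.
Let vr : v != r. Proof. by apply: contraNneq vs => ->; exact: mem_head. Qed.

(** The two halves of the admissibility bound, cleared of denominators: the first makes the thinning
    probability [a] at most 1, the second makes the Poisson rate [l] nonnegative. *)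
Let alphaP : 0 < alpha p v /\ alpha p v * Num.sqrt (lam v) <= Num.sqrt (lam p) /\
  alpha p v * Num.sqrt (lam p) <= Num.sqrt (lam v).
Proof.
have [_ _ /(_ _ _ pv)/andP[a0]] := adm.
rewrite le_min !sqrt_lam_div => /andP[h1 h2].
split=> //; split.
  by rewrite -ler_pdivlMr// sqrtr_gt0.
by rewrite -ler_pdivlMr// sqrtr_gt0.
Qed.

Let aE : a = alpha p v * (Num.sqrt (lam v) / Num.sqrt (lam p)).
Proof. by rewrite /a sqrt_lam_div. Qed.

Let lE : l = lam v - alpha p v * Num.sqrt (lam p) * Num.sqrt (lam v).
Proof.
rewrite /l sqrt_lam_div.
have := sqr_sqrtr (ltW (lam_gt0 v)); have : 0 < Num.sqrt (lam v) by rewrite sqrtr_gt0.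
set x := Num.sqrt (lam v) => x0 <-; field.
by rewrite gt_eqF.
Qed.

Let a01 : 0 <= a <= 1.
Proof.
have [a0 [h1 h2]] := alphaP.
rewrite aE mulr_ge0 ?(ltW a0) ?divr_ge0//=.
by rewrite mulrA ler_pdivrMr ?sqrtr_gt0// mul1r.
Qed.

Let l0 : 0 <= l.
Proof.
have [a0 [h1 h2]] := alphaP.
rewrite lE subr_ge0 -{2}(sqr_sqrtr (ltW (lam_gt0 v))) expr2.
by rewrite ler_wpM2r.
Qed.

Let Z0 j w : 0 <= Z j w. Proof. by []. Qed.

Let EZ j : ('E_P[Z j] = a%:E)%E.
Proof. by apply: expectation_bernoulli a01 _; have [_ ->] := Nstep ppv. Qed.

Let EL : ('E_P[fun w => (L v w)%:R : R] = l%:E)%E.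
Proof. by apply: expectation_poisson l0 _; have [-> _ _] := Nstep ppv. Qed.

Let NvE w : (N v w)%:R = compound (N p) Z w + (L v w)%:R.
Proof. by have [_ _ ->] := Nstep ppv; rewrite natrD natr_thinning. Qed.

Let compound_ge0 w : 0 <= compound (N p) Z w.
Proof. exact: sumr_ge0. Qed.

Let mNp : measurable_fun setT (N p).
Proof. exact: (sub_measurable_fun (@noise_measurable _) (branch_measurable bs (@subset_refl _ _))). Qed.

Let mC : measurable_fun setT (compound (N p) Z).
Proof. by apply: measurable_compound => // j; exact: measurable_natr_bool. Qed.

Let mL : measurable_fun setT (fun w => (L v w)%:R : R).
Proof. exact: measurable_fun_natr. Qed.

Let notin_Is S : v \notin S -> noise_at S `&` Is = set0.
Proof.
move=> vS; apply/seteqP; split => // -[u|[u j]] [/= uS [k]]// [uv _].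
by rewrite uv (negbTE vS) in uS.
Qed.

Let notin_L S : v \notin S -> [set inl v] `&` noise_at S = set0.
Proof.
move=> vS; apply/seteqP; split => // i [/= ->].
by rewrite /noise_at/= (negbTE vS).
Qed.

(** As [Y] uses only noises away from [v], the thinning variables of [v] are independent of the pair
    formed by [N p] and [Y], and [L v] is independent of [Y]. This is the one-edge recursion for
    means and for mixed moments. *)
Lemma expectation_stepM (S : seq V) (Y : Omega -> R) : v \notin S ->
  measurable_fun [set: g_sigma_algebraType (noise_group (noise_at S))]
    (Y : g_sigma_algebraType (noise_group (noise_at S)) -> R) ->
  (forall w, 0 <= Y w) ->
  ('E_P[fun w => ((N v w)%:R * Y w)%R] =
   a%:E * 'E_P[fun w => ((N p w)%:R * Y w)%R] + l%:E * 'E_P[Y])%E.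
Proof.
move=> vS SY Y0.
have mY := sub_measurable_fun (@noise_measurable _) SY.
under [X in ('E_P[X])%E]eq_fun do rewrite NvE mulrDl.
rewrite ge0_expectationD//; first last.
- by move=> w; rewrite mulr_ge0.
- by move=> w; rewrite mulr_ge0.
- exact: measurable_funM.
- exact: measurable_funM.
congr (_ + _)%E.
  (* A single block must contain the noises of both [N p] and [Y]; it avoids [v] because neither the
     branch nor [S] contains it. *)
  apply: (@expectation_compoundM _ _ _ P (noise_group (noise_at (r :: s ++ S)))
    (noise_group Is)) => //.
  - by apply: indep_noise; apply: notin_Is; rewrite -cat_cons mem_cat negb_or vs.
  - apply: branch_measurable bs _ => -[u|[u j]];
    by rewrite /noise_at/= -cat_cons mem_cat => ->.
  - by move=> j; apply: noise_measurableI => //; exists j.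
  - apply: measurable_fun_g_sigmaS SY; apply: sub_class_group => -[u|[u j]];
    by rewrite /noise_at/= -cat_cons mem_cat => ->; rewrite orbT.
rewrite -EL; apply: (@indep_g_sigma_expectationM _ _ _ P (noise_group [set inl v])
  (noise_group (noise_at S))) => //.
- exact: indep_noise (notin_L vS).
- exact: noise_measurableL.
Qed.

(** Only the first two moments of the Poisson marginals are propagated. Expand the square of
    thinning plus Poisson term: the cross product factors because [L v] is independent of both the
    thinning variables and [N p]. *)
Lemma expectation_step_sqr :
  ('E_P[fun w => (N p w)%:R : R] = (lam p)%:E)%E ->
  ('E_P[fun w => ((N p w)%:R ^+ 2)%R : R] = (lam p + lam p ^+ 2)%:E)%E ->
  ('E_P[fun w => ((N v w)%:R ^+ 2)%R : R] = (lam v + lam v ^+ 2)%:E)%E.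
Proof.
move=> Np1 Np2.
have sqE w : (N v w)%:R ^+ 2 = compound (N p) Z w ^+ 2 +
    (2 * (compound (N p) Z w * (L v w)%:R) + (L v w)%:R ^+ 2).
  by rewrite NvE; ring.
under [X in ('E_P[X])%E]eq_fun do rewrite sqE.
have mCL : measurable_fun setT (fun w => compound (N p) Z w * (L v w)%:R).
  exact: measurable_funM.
have CL0 w : 0 <= 2 * (compound (N p) Z w * (L v w)%:R) by rewrite !mulr_ge0.
rewrite (ge0_expectationD P (X := fun w => compound (N p) Z w ^+ 2)
  (Y := fun w => 2 * (compound (N p) Z w * (L v w)%:R) + (L v w)%:R ^+ 2)); first last.
- by move=> w; rewrite addr_ge0 ?sqr_ge0.
- by move=> w; exact: sqr_ge0.
- by apply: measurable_funD; [exact: measurable_funM|exact: measurable_funX].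
- exact: measurable_funX.
rewrite (ge0_expectationD P (X := fun w => 2 * (compound (N p) Z w * (L v w)%:R))
  (Y := fun w => (L v w)%:R ^+ 2))//; first last.
- exact: measurable_funX.
- exact: measurable_funM.
rewrite ge0_expectationZl//; last by move=> w; rewrite mulr_ge0.
rewrite (expectation_poisson_sqr l0); last by have [-> _ _] := Nstep ppv.
rewrite (@expectation_compound_sqr _ _ _ P (noise_group (noise_at (r :: s)))
  (noise_group Is) _ _ _ _ _ _ _ _ a _ a (lam p) (lam p + lam p ^+ 2))//; first last.
- move=> i j ij; rewrite (@indep_g_sigma_expectationM _ _ _ P
    (noise_group [set inr (v, i)]) (noise_group [set inr (v, j)])) ?EZ//.
  + apply: indep_noise; apply/seteqP; split => // k [/= ->] [ij'].
    by rewrite ij' eqxx in ij.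
  + exact: noise_measurableI.
  + exact: noise_measurableI.
(* A Bernoulli variable equals its square, so its second moment is again [a]. *)
- move=> j; rewrite -(EZ j); congr ('E_P[_])%E; apply/funext => w.
  by rewrite /Z; case: (I v j w); rewrite ?expr1n ?expr0n.
- by move=> j; apply: noise_measurableI => //; exists j.
- exact: branch_measurable.
- exact: indep_noise (notin_Is vs).
rewrite (@expectation_compoundM _ _ _ P (noise_group (noise_at (r :: s) `|` [set inl v]))
  (noise_group Is) _ _ _ _ _ _ _ _ a)//; first last.
- by apply: noise_measurableL => //; right.
- by move=> j; apply: noise_measurableI => //; exists j.
- by apply: branch_measurable bs _ => i; left.
- apply: indep_noise; rewrite setIUl (notin_Is vs) set0U.
  by apply/seteqP; split => // i [/= -> []].
rewrite (_ : (fun w => (N p w)%:R * (L v w)%:R) = fun w => (L v w)%:R * (N p w)%:R);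
  last by apply/funext => w; rewrite mulrC.
rewrite (@indep_g_sigma_expectationM _ _ _ P (noise_group [set inl v])
  (noise_group (noise_at (r :: s)))) ?EL ?Np1//; first last.
- apply: measurable_fun_natr; exact: branch_measurable.
- exact: noise_measurableL.
- exact: indep_noise (notin_L vs).
rewrite -!EFinM -!EFinD; congr EFin.
(* The terms add up to x + x ^ 2 with x = a * lam p + l, and [l] is exactly the rate that makes x
   equal to [lam v]. *)
suff <- : a * lam p + l = lam v by ring.
rewrite lE aE.
have := sqr_sqrtr (ltW (lam_gt0 p)); have : 0 < Num.sqrt (lam p) by rewrite sqrtr_gt0.
set x := Num.sqrt (lam p) => x0 <-; field.
by rewrite gt_eqF.
Qed.

End Step.

Lemma branch_moments s : branch adj T r s ->
  ('E_P[fun w => (N (last r s) w)%:R : R] = (lam (last r s))%:E)%E /\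
  ('E_P[fun w => ((N (last r s) w)%:R ^+ 2)%R : R] =
     (lam (last r s) + lam (last r s) ^+ 2)%:E)%E.
Proof.
elim/last_ind: s => [|s v ih] bs.
  rewrite /= (_ : N r = L r); last exact/funext.
  by split; [exact: expectation_poisson (ltW _) Lr|exact: expectation_poisson_sqr (ltW _) Lr].
have [bs' _ _ _ _] := branch_rcons bs.
have [Np1 Np2] := ih bs'.
rewrite last_rcons; split; last exact: expectation_step_sqr bs Np1 Np2.
(* The constant weight 1, which uses no noise, gives the recursion for the mean. *)
have := expectation_stepM bs (S := [::]) (Y := fun=> 1) isT (measurable_cst _) (fun=> ler01).
under [X in ('E_P[X] = _ * _ + _)%E -> _]eq_fun do rewrite mulr1.
under [X in (_ = _ * 'E_P[X] + _)%E -> _]eq_fun do rewrite mulr1.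
rewrite Np1 (expectation_cst P 1) mule1 => ->; rewrite -EFinM -EFinD; congr EFin.
rewrite !sqrt_lam_div.
have := sqr_sqrtr (ltW (lam_gt0 (last r s))); have := sqr_sqrtr (ltW (lam_gt0 v)).
have : 0 < Num.sqrt (lam (last r s)) by rewrite sqrtr_gt0.
have : 0 < Num.sqrt (lam v) by rewrite sqrtr_gt0.
set x := Num.sqrt (lam v); set y := Num.sqrt (lam (last r s)) => x0 y0 <- <-.
by field; rewrite !gt_eqF.
Qed.

Hypothesis adjC : symmetric adj.
Hypothesis branch_inj : forall s t, branch adj T r s -> branch adj T r t ->
  last r s = last r t -> s = t.
Variable abar : R.
Hypothesis alpha_le : forall u v, adj u v -> alpha u v <= abar.

(* The walk of length [n] witnessing [dist_le] need not be a geodesic; this is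
   enough because balls have bounded size. *)
Definition product_moment_bound (u v : V) : Prop :=
  exists n rho, [/\ dist_le adj u v n, 0 <= rho <= abar ^+ n &
    ('E_P[fun w => ((N u w)%:R * (N v w)%:R)%R : R] =
     (lam u * lam v + Num.sqrt (lam u) * Num.sqrt (lam v) * rho)%:E)%E].

Lemma product_moment_boundC u v : product_moment_bound u v -> product_moment_bound v u.
Proof.
move=> [n [rho [[s [us <- sn]] rhoP E]]]; exists n, rho; split => //.
  exists (rev (belast u s)); split; last by rewrite size_rev size_belast.
    rewrite rev_path; apply: sub_path us => x y; by rewrite adjC.
  by case: s {us sn E} => //= x s; rewrite rev_cons last_rcons.
rewrite [lam _ * lam _]mulrC [Num.sqrt _ * Num.sqrt _]mulrC -E.
by congr ('E_P[_])%E; apply/funext => w; rewrite mulrC.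
Qed.

(* [N v] is a thinning of [N (last r t)] by a factor
   [alpha * sqrt (lam v / lam (last r t))] plus an independent Poisson term, so
   the covariance with [N (last r s)] is multiplied by that factor. *)
Lemma product_moment_bound_step s t v : branch adj T r s ->
  branch adj T r (rcons t v) -> v \notin r :: s ->
  product_moment_bound (last r s) (last r t) ->
  product_moment_bound (last r s) v.
Proof.
move=> bs btv vs [n [rho [[q [uq qt qn]] /andP[rho0 rhon] E]]].
have [_ tv _ _ _] := branch_rcons btv.
have [_ _ /(_ _ _ tv)/andP[a0 _]] := adm.
(* [rho] is the correlation, since the variance at a vertex is its [lam]; in this normalisation
   crossing the edge multiplies by [alpha] alone. *)
exists n.+1, (alpha (last r t) v * rho); split.
- exists (rcons q v); split; last by rewrite size_rcons.
    by rewrite rcons_path uq qt.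
  by rewrite last_rcons.
- rewrite mulr_ge0 ?(ltW a0)//= exprS ler_pM//; first exact: ltW.
  exact: alpha_le.
have := expectation_stepM btv vs (Y := fun w => (N (last r s) w)%:R).
have [-> _] := branch_moments bs.
rewrite (_ : (fun w => (N (last r t) w)%:R * _) =
  fun w => (N (last r s) w)%:R * (N (last r t) w)%:R); last first.
  by apply/funext => w; rewrite mulrC.
rewrite E (_ : (fun w => (N v w)%:R * _) = fun w => (N (last r s) w)%:R * (N v w)%:R);
  last by apply/funext => w; rewrite mulrC.
move=> -> //; last by apply: measurable_fun_natr; exact: branch_measurable.
rewrite -!EFinM -EFinD; congr EFin.
rewrite !sqrt_lam_div.
have := sqr_sqrtr (ltW (lam_gt0 (last r t))); have := sqr_sqrtr (ltW (lam_gt0 v)).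
have : 0 < Num.sqrt (lam (last r t)) by rewrite sqrtr_gt0.
have : 0 < Num.sqrt (lam v) by rewrite sqrtr_gt0.
set x := Num.sqrt (lam v); set y := Num.sqrt (lam (last r t)) => x0 y0 <- <-.
by field; rewrite !gt_eqF.
Qed.

Lemma branch_product_moment s t : branch adj T r s -> branch adj T r t ->
  product_moment_bound (last r s) (last r t).
Proof.
have [m] := ubnP (size s + size t); elim: m s t => // m ih s t stm bs bt.
(* The deeper vertex is not an ancestor of the other one: peel it off. *)
wlog st : s t stm bs bt / (size s <= size t)%N.
  move=> wl; case: (leqP (size s) (size t)) => [st|/ltnW ts]; first exact: wl.
  by apply: product_moment_boundC; apply: wl => //; rewrite addnC.
have [suv|suv] := eqVneq (last r s) (last r t).
  have [_ E2] := branch_moments bt.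
  (* On the diagonal the correlation is 1, at distance 0. *)
  exists 0%N, 1; rewrite suv; split; [by exists [::]|by rewrite expr0 lexx ler01|].
  rewrite (_ : (fun w => _) = fun w => (N (last r t) w)%:R ^+ 2) ?E2; last first.
    by apply/funext => w; rewrite expr2.
  by congr EFin; rewrite mulr1 -!expr2 sqr_sqrtr ?ltW// addrC.
case/lastP: t => [|t v] in stm bt st suv *.
  by move: st suv; rewrite leqn0 size_eq0 => /eqP ->; rewrite eqxx.
have [bt' _ _ _ _] := branch_rcons bt.
rewrite last_rcons.
apply: (product_moment_bound_step bs bt); last first.
  by apply: ih => //; move: stm; rewrite size_rcons addnS ltnS.
(* If [v] were on the branch [s], the prefix of [s] ending at [v] would be [rcons t v] by uniqueness
   of paths; as [s] is not longer, it would have the same endpoint, a case already excluded. *)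
apply/negP => vs.
have [q [q' [sE qv]]] : exists q q', s = q ++ q' /\ last r q = v.
  by case/splitPl: vs => q q' <-; exists q, q'.
have bq : branch adj T r q.
  case: bs => ps us subs; move: ps us; rewrite sE cat_path -cat_cons cat_uniq.
  move=> /andP[pq _] /andP[uq _]; split=> // x xq; apply: subs.
  by rewrite sE -cat_cons mem_cat xq.
have qE : q = rcons t v by apply: branch_inj => //; rewrite last_rcons.
have q'0 : q' = [::].
  apply: size0nil; move: st; rewrite sE size_cat qE.
  by rewrite -[X in (_ <= X)%N]addn0 leq_add2l leqn0 => /eqP.
by move: suv; rewrite sE q'0 cats0 qE eqxx.
Qed.

End MPMRFMoments.

(** * Transfer of moments through the joint law *)

Lemma measurable_fun_fibers d (T : measurableType d) (G : T -> nat) :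
  (forall n, measurable (G @^-1` [set n])) -> measurable_fun setT G.
Proof.
move=> mG _ Y _; rewrite setTI (_ : _ @^-1` _ = \bigcup_(n in Y) (G @^-1` [set n])).
  by apply: bigcup_measurable => n _; exact: mG.
by apply/seteqP; split => [w Yw|w [n Yn /= ->]] //; exists (G w).
Qed.

Section Transfer.
Context {R : realType} {V : choiceType} (T : {fset V}).

Definition restr_counts (Omega : Type) (N : V -> Omega -> nat) (w : Omega) :
  {ffun T -> nat} := [ffun v => N (val v) w].

Definition extend_counts (k : {ffun T -> nat}) (v : V) : nat :=
  if insub v is Some x then k x else 0%N.

Lemma restr_counts_eq (Omega : Type) (N : V -> Omega -> nat) (k : {ffun T -> nat}) w :
  restr_counts N w = k <-> forall v, v \in T -> N v w = extend_counts k v.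
Proof.
split=> [<- v vT|Nk].
  by rewrite /extend_counts insubT ffunE.
apply/ffunP => v; rewrite ffunE Nk; last exact: valP.
rewrite /extend_counts.
by case: insubP => [x _ /val_inj -> //|/negP[]]; exact: valP.
Qed.

(** The fibre over a code is one of the events whose probability the joint mass function prescribes;
    an integer that encodes no vector has an empty fibre. *)
Lemma restr_counts_fiber (Omega : Type) (N : V -> Omega -> nat) (n : nat) :
  (fun w => choice.pickle (restr_counts N w)) @^-1` [set n] =
  if pickle_inv n is Some k then
    [set w | forall v, v \in T -> N v w = extend_counts k v]
  else set0.
Proof.
have := @pickle_invK {ffun T -> nat} n.
case E : (pickle_inv n) => [k|] /= kn; apply/seteqP; split => w //=.
- by move=> nE; move: E; rewrite -nE pickleK_inv => -[/restr_counts_eq].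
- by move=> /restr_counts_eq ->.
- by move=> nE; move: E; rewrite -nE pickleK_inv.
Qed.

Lemma measurable_restr_counts d (Omega : measurableType d) (N : V -> Omega -> nat) :
  (forall v, v \in T -> measurable_fun setT (N v)) ->
  measurable_fun setT (fun w => choice.pickle (restr_counts N w)).
Proof.
move=> mN; apply: measurable_fun_fibers => n; rewrite restr_counts_fiber.
case: pickle_inv => [k|]; last exact: measurable0.
rewrite (_ : [set w | _] = \bigcap_(v in [set` T]) (N v @^-1` [set extend_counts k v])).
  apply: fin_bigcap_measurable; first exact: finite_fset.
  by move=> v /= vT; rewrite -[X in measurable X]setTI; exact: mN.
by apply/seteqP; split.
Qed.

(* The count vector on [T] is encoded by a single natural number, whose law is
   determined by the joint probability mass function. *)
Lemma eq_pmf_expectation d (Omega : measurableType d) (P : probability Omega R)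
    (N : V -> Omega -> nat) d' (Omega' : measurableType d')
    (P' : probability Omega' R) (N' : V -> Omega' -> nat) (h : {ffun T -> nat} -> R) :
  (forall v, v \in T -> measurable_fun setT (N v)) ->
  (forall v, v \in T -> measurable_fun setT (N' v)) ->
  (forall k : V -> nat, P [set w | forall v, v \in T -> N v w = k v] =
     P' [set w | forall v, v \in T -> N' v w = k v]) ->
  (forall k, 0 <= h k) ->
  ('E_P[h \o restr_counts N] = 'E_P'[h \o restr_counts N'])%E.
Proof.
move=> mN mN' NN' h0.
pose g n := if pickle_inv n is Some k then h k else 0.
have g0 n : 0 <= g n by rewrite /g; case: pickle_inv.
have hE (Om : Type) (M : V -> Om -> nat) :
    h \o restr_counts M = g \o (fun w => choice.pickle (restr_counts M w)).
  by apply/funext => w; rewrite /g /= pickleK_inv.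
rewrite !hE !ge0_expectation_nat//; [|exact: measurable_restr_counts..].
apply: eq_eseriesr => n _; congr (_ * _)%E.
by rewrite !restr_counts_fiber; case: pickle_inv => [k|]; rewrite ?NN' ?measure0.
Qed.

End Transfer.

Lemma tree_branch_inj (V : choiceType) (adj : rel V) (T : {fset V}) (r : V)
    (s t : seq V) : is_tree adj -> branch adj T r s -> branch adj T r t ->
  last r s = last r t -> s = t.
Proof.
move=> [_ _ adjU] [ps us _] [pt ut _] st.
have [q [_ qU]] := adjU r (last r s).
by rewrite -(qU s)// -(qU t).
Qed.

Section MPMRFLaw.
Context {R : realType} {V : choiceType} {d : measure_display}
  {Omega : measurableType d}.
Variables (lam : V -> R) (alpha : V -> V -> R) (adj : rel V) (T : {fset V}).
Variables (P : probability Omega R) (N : V -> {RV P >-> nat}).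
Hypothesis adm : admissible adj lam alpha.
Hypothesis tree : is_tree adj.
Hypothesis T_connected : forall u v, u \in T -> v \in T ->
  exists s, branch adj T u s /\ last u s = v.
Variable abar : R.
Hypothesis alpha_le : forall u v, adj u v -> alpha u v <= abar.
Hypothesis N_law : is_mpmrf lam alpha adj T P (fun v => N v).

(** The representation comes with its own probability space and its own root, which may be any
    vertex of [T]; this is why connectedness is required between all pairs of vertices. *)
Lemma mpmrf_moments u v : u \in T -> v \in T ->
  [/\ ('E_P[fun w => (N u w)%:R : R] = (lam u)%:E)%E,
      ('E_P[fun w => ((N u w)%:R ^+ 2)%R : R] = (lam u + lam u ^+ 2)%:E)%E &
      product_moment_bound lam adj P (fun v => N v) abar u v].
Proof.
move=> uT vT.
have [d0 [Om0 [P0 [N0 [[r [L [I [rT indLI Lr NLr Nstep]]]] NN0]]]]] := N_law.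
have [adjC _ _] := tree.
(* The representing counts are plain functions; their measurability follows from the recursion along
   a branch. *)
have mN0 w : w \in T -> measurable_fun setT (N0 w).
  move=> /(T_connected rT)[s [bs <-]].
  apply: sub_measurable_fun (branch_measurable rT NLr Nstep bs (@subset_refl _ _)).
  apply: class_group_measurable => -[x|[x j]] _; exact: sigma_rv_measurable.
have transfer (g : nat -> nat -> R) : (forall a b, 0 <= g a b) ->
    ('E_P[fun w => g (N u w) (N v w)] = 'E_P0[fun w => g (N0 u w) (N0 v w)])%E.
  move=> g0.
  pose h (k : {ffun T -> nat}) := g (k (FSetSub uT)) (k (FSetSub vT)).
  have hE (Om : Type) (M : V -> Om -> nat) :
      h \o restr_counts T M = fun w => g (M u w) (M v w).
    by apply/funext => w; rewrite /h /= !ffunE.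
  rewrite -(hE _ N) -(hE _ N0).
  exact: (eq_pmf_expectation (fun v (_ : v \in T) => measurable_funPT (N v)) mN0 NN0
    (h := h) (fun=> g0 _ _)).
have [p [bp pu]] := T_connected rT uT.
have [q [bq qv]] := T_connected rT vT.
have [E1 E2] := branch_moments adm rT indLI Lr NLr Nstep bp.
have [n [rho [n_dist rhoP Euv]]] := branch_product_moment adm rT indLI Lr NLr Nstep
  adjC (fun s t => @tree_branch_inj _ adj T r s t tree) alpha_le bp bq.
rewrite pu in E1 E2; rewrite pu qv in n_dist Euv.
split.
- by rewrite -E1; exact: (transfer (fun a _ => a%:R)).
- by rewrite -E2; apply: (transfer (fun a _ => a%:R ^+ 2)) => a _; exact: sqr_ge0.
exists n, rho; split => //; rewrite -Euv.
by apply: (transfer (fun a b => a%:R * b%:R)) => a b; exact: mulr_ge0.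
Qed.

End MPMRFLaw.

(** * Balls of the Bethe lattice *)

Section Balls.
Context {V : choiceType} (chi : nat) (adj : rel V).
Hypothesis bethe : is_bethe_lattice chi adj.

Let nbrs (v : V) : {fset V} := fset_set [set w | adj v w].

Let nbrsP v w : (w \in nbrs v) = adj v w.
Proof.
have [_ _ /(_ v) vchi] := bethe.
rewrite in_fset_set; last by apply/finite_setP; exists chi.
by apply/idP/idP => [/set_mem//|vw]; exact: mem_set.
Qed.

(** One entry for each walk of length at most [k] from [u], namely its endpoint. Repetitions are
    kept so that the length depends on [k] and the degree only, which gives a bound on balls uniform
    in the centre. *)
Fixpoint reach (k : nat) (u : V) : seq V :=
  u :: if k is k'.+1 then flatten [seq reach k' w | w <- nbrs u] else [::].

Fixpoint reach_size (k : nat) : nat :=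
  (if k is k'.+1 then chi * reach_size k' else 0).+1.

Lemma size_reach k u : size (reach k u) = reach_size k.
Proof.
elim: k u => //= k ih u; congr _.+1.
have [_ _ /(_ u) uchi] := bethe.
rewrite size_flatten /shape -map_comp.
rewrite (eq_map (g := fun=> reach_size k)); last by move=> w /=; exact: ih.
rewrite -(card_fset_set uchi); elim: (enum_fset (nbrs u)) => //= w s ->.
by rewrite mulSn.
Qed.

Lemma dist_le_reach k u v : dist_le adj u v k -> v \in reach k u.
Proof.
elim: k u => [|k ih] u [[|w s] [us uv sk]] //=; rewrite in_cons.
- by rewrite -uv/= eqxx.
- by rewrite -uv/= eqxx.
apply/orP; right; move: us => /= /andP[uw ws].
apply/flattenP; exists (reach k w); first by apply: map_f; rewrite nbrsP.
by apply: ih; exists s.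
Qed.

(** The set must be shown finite, as a subset of [reach n r], because [fset_set] is empty on
    infinite sets. *)
Lemma in_ball_at r n v : v \in ball_at adj r n <-> dist_le adj r v n.
Proof.
have fin : finite_set [set v | dist_le adj r v n].
  apply: (@sub_finite_set _ _ [set` reach n r]); last exact: finite_seq.
  by move=> w /= /dist_le_reach.
rewrite /ball_at in_fset_set//; split => [/set_mem//|vn]; exact: mem_set.
Qed.

Lemma ball_at_path r n s : path adj r s -> (size s <= n)%N ->
  {subset r :: s <= ball_at adj r n}.
Proof.
move=> rs sn x /splitPl xs; case: xs rs sn => s1 s2 <-.
rewrite cat_path size_cat => /andP[rs1 _] sn; apply/in_ball_at; exists s1.
by split=> //; rewrite (leq_trans _ sn)// leq_addr.
Qed.

(** Walk from [u] back to the centre and out to [v], which stays in the ball, then erase the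
    loops. *)
Lemma ball_at_connected r n u v : u \in ball_at adj r n -> v \in ball_at adj r n ->
  exists s, branch adj (ball_at adj r n) u s /\ last u s = v.
Proof.
have [_ [adjC _ _] _] := bethe.
move=> /in_ball_at[s [rs su sn]] /in_ball_at[t [rt tv tn]].
pose q := rev (belast r s) ++ t.
have lr : last u (rev (belast r s)) = r.
  by rewrite -su; case: (s) => //= x s'; rewrite rev_cons last_rcons.
have uq : path adj u q.
  rewrite cat_path lr rt andbT -su rev_path.
  by apply: sub_path rs => x y; rewrite adjC.
have qv : last u q = v by rewrite last_cat lr.
have qball : {subset u :: q <= ball_at adj r n}.
  move=> x; rewrite in_cons mem_cat mem_rev => /or3P[/eqP ->|xs|xt].
  - by apply: (ball_at_path rs sn); rewrite -su mem_last.
  - by apply: (ball_at_path rs sn); exact: mem_belast.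
  - by apply: (ball_at_path rt tn); rewrite in_cons xt orbT.
case/shortenP: uq qv => p up uup pq pv; exists p; split => //; split => //.
move=> x; rewrite in_cons => /orP[/eqP ->|/pq xq]; apply: qball.
  exact: mem_head.
by rewrite in_cons xq orbT.
Qed.

(** An infinite tree has a finite set of at least [M] vertices, and every ball of large enough
    radius contains it because the tree is connected. *)
Lemma ball_at_card_unbounded r M : exists n0, forall n, (n0 <= n)%N ->
  (M <= #|` ball_at adj r n|)%N.
Proof.
have [Vinf [_ _ adjU] _] := bethe.
have [A _ MA] := infinite_set_fset M Vinf.
have /choice[f fP] : forall v, exists n, dist_le adj r v n.
  by move=> v; have [s [[rs sv _] _]] := adjU r v; exists (size s), s.
exists (\max_(v <- A) f v) => n fn; apply: (leq_trans MA).
apply/fsubset_leq_card/fsubsetP => v vA; apply/in_ball_at.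
have [s [rs sv sf]] := fP v; exists s; split => //.
by apply: (leq_trans sf); apply: leq_trans fn; exact: leq_bigmax_seq.
Qed.

Lemma sum_dist_le (R : realType) (T : {fset V}) u k :
  \sum_(v <- T) (`[< dist_le adj u v k >])%:R <= (reach_size k)%:R :> R.
Proof.
rewrite -natr_sum ler_nat -(size_reach k u).
rewrite -big_mkcond /= sum1_count -size_filter.
apply: uniq_leq_size; first by rewrite filter_uniq.
by move=> v; rewrite mem_filter => /andP[/asboolP vk _]; exact: dist_le_reach.
Qed.

End Balls.

(** * Variance of the mean aggregate *)

(** From x <= 1 + x ^ 2: the bound on second moments of the claims also makes their means finite and
    uniformly bounded. *)
Lemma expectation_le1sqr d (T : measurableType d) (R : realType)
    (P : probability T R) (X : T -> R) : measurable_fun setT X ->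
  (forall w, 0 <= X w) ->
  ('E_P[X] <= 1 + 'E_P[fun w => (X w ^+ 2)%R])%E.
Proof.
move=> mX X0; rewrite -(expectation_cst P 1%R) -ge0_expectationD//; first last.
- by move=> w; exact: sqr_ge0.
- exact: measurable_funX.
rewrite !unlock; apply: ge0_le_integral => //.
- by move=> w _; rewrite lee_fin.
- exact/measurable_EFinP.
- by apply/measurable_EFinP; apply: measurable_funD => //; exact: measurable_funX.
- by move=> w _; rewrite lee_fin /=; have := X0 w; nra.
Qed.

Section SecondMoment.
Context {d : measure_display} {Omega : measurableType d} {R : realType}
  {V : choiceType}.
Variables (P : probability Omega R) (adj : rel V) (T : {fset V}) (lam : V -> R).
Variables (N : V -> {RV P >-> nat}) (Bs : V -> nat -> {RV P >-> R}).
Variables (m s : V -> R) (abar Lam S : R).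
Hypothesis Bs_ge0 : forall v j w, 0 <= Bs v j w.
Hypothesis Bs_m : forall v j, ('E_P[Bs v j] = (m v)%:E)%E.
Hypothesis Bs_s : forall v j, ('E_P[fun w => (Bs v j w ^+ 2)%R] = (s v)%:E)%E.
Hypothesis Bs_indep : forall v, independent P [set: nat] (fun j => sigma_rv (Bs v j)).
Hypothesis NBs_indep : independent P
  [set i : option V | if i is Some v then v \in T else true]
  (count_claims_sigma T (fun v => N v) (fun v j => Bs v j)).
Hypothesis lam_gt0 : forall v, 0 < lam v.
Hypothesis lam_le : forall v, lam v <= Lam.
Hypothesis s_le : forall v, s v <= S.
Hypothesis abar01 : 0 <= abar <= 1.
Hypothesis N_moments : forall u v, u \in T -> v \in T ->
  [/\ ('E_P[fun w => (N u w)%:R : R] = (lam u)%:E)%E,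
      ('E_P[fun w => ((N u w)%:R ^+ 2)%R : R] = (lam u + lam u ^+ 2)%:E)%E &
      product_moment_bound lam adj P (fun v => N v) abar u v].

Let X (v : V) : Omega -> R := compound (N v) (Bs v).
Let D := [set i : option V | if i is Some v then v \in T else true].
Let F := count_claims_sigma T (fun v => N v) (fun v j => Bs v j).
Let group (J : set (option V)) := class_group D F J.

Let mX v : measurable_fun setT (X v).
Proof. exact: measurable_compound. Qed.

Let X0 v w : 0 <= X v w.
Proof. exact: sumr_ge0. Qed.

Let Fsigma i : sigma_algebra setT (F i).
Proof. by case: i => [v|]; exact: smallest_sigma_algebra. Qed.

Let FT i : D i -> F i setT.
Proof. by move=> _; have [F0 FC _] := Fsigma i; rewrite -(setD0 setT); exact: FC. Qed.

Let FI i : D i -> setI_closed (F i).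
Proof.
move=> _ A B FA FB; move: FA FB; rewrite -(sigma_algebra_id (Fsigma i)).
exact: (@measurableI _ (g_sigma_algebraType (F i))).
Qed.

Let Fm i : D i -> F i `<=` measurable.
Proof.
case: i => [v|] _; apply: (smallest_sub (@sigma_algebra_measurable _ Omega));
  by move=> A [j _ jA]; exact: (sigma_rv_measurable _ jA).
Qed.

Let groupm J : group J `<=` measurable.
Proof. exact: class_group_measurable. Qed.

Let indep_group J1 J2 : J1 `&` J2 = set0 ->
  indep_classes P <<s group J1 >> <<s group J2 >>.
Proof. exact: indep_class_group. Qed.

Let groupN J v : v \in T -> J None ->
  measurable_fun [set: g_sigma_algebraType (group J)]
    (N v : g_sigma_algebraType (group J) -> nat).
Proof.
move=> vT JN; apply: (class_group_rv (i := None)) => // A sA.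
by apply: sub_sigma_algebra; exists v.
Qed.

Let groupB J v j : v \in T -> J (Some v) ->
  measurable_fun [set: g_sigma_algebraType (group J)]
    (Bs v j : g_sigma_algebraType (group J) -> R).
Proof.
move=> vT JN; apply: (class_group_rv (i := Some v)) => // A sA.
by apply: sub_sigma_algebra; exists j.
Qed.

Let groupX J v : v \in T -> J None -> J (Some v) ->
  measurable_fun [set: g_sigma_algebraType (group J)]
    (X v : g_sigma_algebraType (group J) -> R).
Proof.
move=> vT JN Jv; apply: (@measurable_compound _ (g_sigma_algebraType (group J))).
  exact: groupN.
by move=> j; exact: groupB.
Qed.

Let None_Some v : [set (None : option V)] `&` [set Some v] = set0.
Proof. by apply/seteqP; split => // i [/= ->]. Qed.

Let m_ge0 v : 0 <= m v.
Proof. by rewrite -lee_fin -(Bs_m v 0); exact: expectation_ge0. Qed.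

Let s_ge0 v : 0 <= s v.
Proof.
by rewrite -lee_fin -(Bs_s v 0); apply: expectation_ge0 => w; exact: sqr_ge0.
Qed.

Let m_le v : m v <= 1 + S.
Proof.
have := @expectation_le1sqr _ _ _ P (Bs v 0) (measurable_funPT _) (Bs_ge0 v 0).
rewrite Bs_m Bs_s -EFinD lee_fin => /le_trans; apply.
by rewrite lerD2l.
Qed.

Lemma expectation_claims v : v \in T -> ('E_P[X v] = (m v * lam v)%:E)%E.
Proof.
move=> vT; have [EN _ _] := N_moments vT vT.
rewrite (@expectation_compound _ _ _ P (group [set (None : option V)]) (group [set Some v])
  _ _ _ _ _ _ _ _ (m v)) ?EN//.
- exact: indep_group.
- exact: groupN.
- by move=> j; exact: groupB.
Qed.

Lemma expectation_claims_sqr v : v \in T ->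
  ('E_P[fun w => (X v w ^+ 2)%R] = (m v ^+ 2 * lam v ^+ 2 + s v * lam v)%:E)%E.
Proof.
move=> vT; have [EN EN2 _] := N_moments vT vT.
rewrite (@expectation_compound_sqr _ _ _ P (group [set (None : option V)]) (group [set Some v])
  _ _ _ _ _ _ _ _ (m v) _ (s v) (lam v) (lam v + lam v ^+ 2))//.
- by congr EFin; ring.
- exact: indep_group.
- exact: groupN.
- by move=> j; exact: groupB.
(* Two distinct claims at the same vertex are independent: group the sequence into singletons. *)
move=> i j ij; rewrite expr2 EFinM -{1}(Bs_m v i) -(Bs_m v j).
apply: indep_expectationM => // A B sA sB.
have := indep_class_group (@Bs_indep v) (fun j _ => sigma_rvT (Bs v j))
  (fun j _ => @sigma_rvI _ _ _ _ (Bs v j))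
  (fun j _ => sigma_rv_measurable (measurable_funPT (Bs v j)))
  (J1 := [set i]) (J2 := [set j]).
apply.
- by apply/seteqP; split => // k [/= ->] /eqP; rewrite (negbTE ij).
- by apply: sub_sigma_algebra; exists i.
- by apply: sub_sigma_algebra; exists j.
Qed.

(** The claims are averaged out one vertex at a time: those of [u] with weight [X v], then those of
    [v] with weight [N u]. *)
Lemma expectation_claimsM u v : u \in T -> v \in T -> u != v ->
  ('E_P[fun w => (X u w * X v w)%R] =
   (m u * m v)%:E * 'E_P[fun w => ((N u w)%:R * (N v w)%:R)%R : R])%E.
Proof.
move=> uT vT uv.
rewrite (@expectation_compoundM _ _ _ P (group [set None; Some v]) (group [set Some u])
  _ _ _ _ _ _ _ _ (m u))//; first last.
- by apply: groupX => //; [left|right].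
- by move=> j; exact: groupB.
- by apply: groupN => //; left.
- apply: indep_group; apply/seteqP; split => // i [/= [] ->] // [vu].
  by rewrite vu eqxx in uv.
rewrite (_ : (fun w => (N u w)%:R * X v w) = fun w => X v w * (N u w)%:R); last first.
  by apply/funext => w; rewrite mulrC.
rewrite (@expectation_compoundM _ _ _ P (group [set (None : option V)]) (group [set Some v])
  _ _ _ _ _ _ _ _ (m v))//; first last.
- by apply: measurable_fun_natr; exact: groupN.
- by move=> j; exact: groupB.
- exact: groupN.
- exact: indep_group.
rewrite muleA -EFinM; congr (_ * 'E_P[_])%E.
by apply/funext => w; rewrite mulrC.
Qed.

(** The factor (1 + S) ^ 2 dominates both a product of two claim means and, on the diagonal, a
    second moment of a claim; [Lam] dominates both sqrt (lam u) * sqrt (lam v) and [lam u]. *)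
Let C := (1 + S) ^+ 2 * Lam.

Lemma expectation_claimsM_le u v k : u \in T -> v \in T ->
  ('E_P[fun w => (X u w * X v w)%R] <= (m u * lam u * (m v * lam v) +
     C * ((`[< dist_le adj u v k >])%:R + abar ^+ k))%:E)%E.
Proof.
move=> uT vT.
have S0 : 0 <= S by exact: le_trans (s_ge0 u) (s_le u).
have Lam0 : 0 <= Lam by exact: le_trans (ltW (lam_gt0 u)) (lam_le u).
have C0 : 0 <= C by rewrite mulr_ge0// sqr_ge0.
have /andP[abar0 abar1] := abar01.
have abark : 0 <= abar ^+ k by exact: exprn_ge0.
have [<-|uv] := eqVneq u v.
  (* On the diagonal the excess over the squared mean is [s u * lam u], absorbed by the indicator
     since [u] is at distance 0 from itself. *)
  rewrite (_ : (fun w => _) = fun w => X u w ^+ 2); last first.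
    by apply/funext => w; rewrite expr2.
  rewrite expectation_claims_sqr// lee_fin.
  rewrite (_ : `[< _ >] = true); last by apply/asboolP; exists [::].
  have -> : m u * lam u * (m u * lam u) = m u ^+ 2 * lam u ^+ 2 by ring.
  rewrite lerD2l (@le_trans _ _ C)//; last by rewrite ler_peMr// lerDl.
  rewrite /C ler_pM ?s_ge0 ?(ltW (lam_gt0 u))// (le_trans (s_le u))//.
  by nra.
have [_ _ [n [rho [uvn /andP[rho0 rhon] EN]]]] := N_moments uT vT.
rewrite expectation_claimsM// EN -EFinM lee_fin mulrDr.
have -> : m u * m v * (lam u * lam v) = m u * lam u * (m v * lam v) by ring.
rewrite lerD2l mulrA ler_pM//.
- by rewrite !mulr_ge0.
- rewrite /C ler_pM//.
  + by rewrite mulr_ge0.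
  + by rewrite expr2 ler_pM.
  + rewrite -[Lam in X in _ <= X]sqr_sqrtr// expr2.
    by rewrite ler_pM// ler_wsqrtr.
(* [rho <= abar ^ n <= abar ^ k] unless [v] lies within distance [k] of [u]. *)
case: (leqP n k) => [nk|/ltnW kn].
  rewrite (_ : `[< _ >] = true).
    apply: (le_trans rhon); apply: (le_trans (exprn_ile1 n abar0 abar1)).
    by rewrite lerDl.
  apply/asboolP; have [q [uq qv qn]] := uvn.
  by exists q; split => //; exact: leq_trans qn nk.
apply: (le_trans rhon); apply: (le_trans (ler_wiXn2l abar0 abar1 kn)).
by rewrite lerDr.
Qed.

Lemma measurable_mean_aggregate :
  measurable_fun setT (mean_aggregate T (fun v => N v) (fun v j => Bs v j)).
Proof.
apply: measurable_funM => //; apply: measurable_sum => v; exact: mX.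
Qed.

Lemma mean_aggregate_ge0 w : 0 <= mean_aggregate T (fun v => N v) (fun v j => Bs v j) w.
Proof. by rewrite divr_ge0// sumr_ge0// => v _; exact: X0. Qed.

Let mu := (\sum_(v <- T) m v * lam v) / #|` T|%:R.

Lemma expectation_mean_aggregate :
  ('E_P[mean_aggregate T (fun v => N v) (fun v j => Bs v j)] = mu%:E)%E.
Proof.
rewrite (_ : mean_aggregate _ _ _ = fun w => #|` T|%:R^-1 * \sum_(v <- T) X v w);
  last by apply/funext => w; rewrite mulrC.
rewrite ge0_expectationZl ?invr_ge0//; first last.
- by move=> w; rewrite sumr_ge0.
- exact: measurable_sum.
rewrite ge0_expectation_sum// (eq_big_seq (fun v => (m v * lam v)%:E)).
  by rewrite sumEFin -EFinM mulrC.
by move=> v vT; exact: expectation_claims.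
Qed.

Lemma expectation_mean_aggregate_sqr (k M : nat) : (0 < #|` T|)%N ->
  (forall u, \sum_(v <- T) (`[< dist_le adj u v k >])%:R <= M%:R :> R) ->
  ('E_P[fun w => (mean_aggregate T (fun v => N v) (fun v j => Bs v j) w ^+ 2)%R] <=
   (mu ^+ 2 + C * (M%:R / #|` T|%:R + abar ^+ k))%:E)%E.
Proof.
move=> T0 distM; set n := #|` T|%:R.
have n0 : 0 < n :> R by rewrite ltr0n.
rewrite (_ : (fun w => _) = fun w => n ^- 2 * \sum_(u <- T) \sum_(v <- T) X u w * X v w);
  last first.
  apply/funext => w; rewrite /mean_aggregate expr_div_n mulrC; congr (_ * _).
  by rewrite expr2 mulr_suml; apply: eq_bigr => u _; rewrite mulr_sumr.
have XX0 u v w : 0 <= X u w * X v w by rewrite mulr_ge0.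
have mXX u v : measurable_fun setT (fun w => X u w * X v w) by exact: measurable_funM.
rewrite ge0_expectationZl ?invr_ge0 ?sqr_ge0//; first last.
- by move=> w; apply: sumr_ge0 => u _; exact: sumr_ge0.
- by apply: measurable_sum => u; exact: measurable_sum.
rewrite ge0_expectation_sum//; first last.
- by move=> u w; exact: sumr_ge0.
- by move=> u; exact: measurable_sum.
pose b u v := m u * lam u * (m v * lam v) +
  C * ((`[< dist_le adj u v k >])%:R + abar ^+ k).
apply: (@le_trans _ _ ((n ^- 2)%:E * (\sum_(u <- T) \sum_(v <- T) b u v)%:E)%E).
  rewrite lee_wpmul2l ?lee_fin ?invr_ge0 ?sqr_ge0//.
  rewrite -sumEFin big_seq [leRHS]big_seq; apply: lee_sum => u uT.
  rewrite ge0_expectation_sum// -sumEFin big_seq [leRHS]big_seq.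
  by apply: lee_sum => v vT; exact: expectation_claimsM_le.
rewrite -EFinM lee_fin mulrC ler_pdivrMr ?exprn_gt0//.
have card_sum (x : R) : \sum_(v <- T) x = n * x.
  by rewrite big_const_seq count_predT iter_addr_0 mulr_natl.
(* Each of the [n] rows contributes at most [M] to the sum of indicators and n * abar ^ k to the
   remaining terms; division by n ^ 2 then leaves M / n + abar ^ k. *)
apply: (@le_trans _ _ (\sum_(u <- T) (m u * lam u * (mu * n) +
    C * (M%:R + n * abar ^+ k)))).
  apply: ler_sum => u _; rewrite big_split/= -mulr_sumr lerD//.
    by rewrite /mu divfK// gt_eqF.
  rewrite -mulr_sumr big_split/= card_sum ler_wpM2l// ?lerD2r//.
  have S0 : 0 <= S by exact: le_trans (s_ge0 u) (s_le u).
  have Lam0 : 0 <= Lam by exact: le_trans (ltW (lam_gt0 u)) (lam_le u).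
  by rewrite mulr_ge0// sqr_ge0.
rewrite big_split/= -mulr_suml card_sum.
have -> : \sum_(i <- T) m i * lam i = mu * n by rewrite /mu divfK// gt_eqF.
by rewrite le_eqVlt; apply/orP; left; apply/eqP; field; rewrite gt_eqF.
Qed.

Lemma variance_mean_aggregate_le (k M : nat) : (0 < #|` T|)%N ->
  (forall u, \sum_(v <- T) (`[< dist_le adj u v k >])%:R <= M%:R :> R) ->
  ('V_P[mean_aggregate T (fun v => N v) (fun v j => Bs v j)] <=
   (C * (M%:R / #|` T|%:R + abar ^+ k))%:E)%E.
Proof.
move=> T0 distM.
have := expectation_mean_aggregate_sqr T0 distM.
set W := mean_aggregate _ _ _.
have mW : measurable_fun setT W by exact: measurable_mean_aggregate.
have W0 w : 0 <= W w by exact: mean_aggregate_ge0.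
have EW : ('E_P[W] = mu%:E)%E by exact: expectation_mean_aggregate.
have mu0 : 0 <= mu by rewrite -lee_fin -EW; exact: expectation_ge0.
rewrite /variance covariance.unlock EW /=.
have -> : (W \- cst mu) * (W \- cst mu) = fun w => (W w - mu) ^+ 2.
  by apply/funext => w; rewrite expr2.
have mWmu : measurable_fun setT (fun w => (W w - mu) ^+ 2).
  by apply: measurable_funX; exact: measurable_funB.
(* The expansion of the square is rearranged so that both sides are sums of nonnegative terms. *)
have : ('E_P[fun w => ((W w - mu) ^+ 2 + 2 * mu * W w)%R] =
        'E_P[fun w => (W w ^+ 2 + mu ^+ 2)%R])%E.
  by congr ('E_P[_])%E; apply/funext => w; ring.
rewrite ge0_expectationD//; first last.
- by move=> w; apply: mulr_ge0 => //; exact: mulr_ge0.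
- by move=> w; exact: sqr_ge0.
- exact: measurable_funM.
rewrite ge0_expectationD//; first last.
- by move=> _; exact: sqr_ge0.
- by move=> w; exact: sqr_ge0.
- exact: measurable_funX.
have mu20 : 0 <= 2 * mu by exact: mulr_ge0.
rewrite (ge0_expectationZl P mW W0 mu20) EW.
rewrite (expectation_cst P (mu ^+ 2)) => E.
move=> E2.
have {}E : ('E_P[fun w => ((W w - mu) ^+ 2)%R] + (2 * mu * mu)%:E <=
    (mu ^+ 2 + C * (M%:R / #|` T|%:R + abar ^+ k) + mu ^+ 2)%:E)%E.
  by rewrite EFinM E [leRHS]EFinD leeD2r.
rewrite -(leeD2rE _ _ (x := (2 * mu * mu)%:E))//; apply: (le_trans E).
by rewrite -EFinD lee_fin; nra.
Qed.

End SecondMoment.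

(** * Convergence in probability *)

Lemma ereal_sup_lt_bound (R : realType) (I : Type) (A : set I) (f : I -> \bar R)
    (c : \bar R) : (0 < c)%E -> (ereal_sup [set f i | i in A] < c)%E ->
  exists M : R, [/\ 0 <= M, (M%:E < c)%E & forall i, A i -> (f i <= M%:E)%E].
Proof.
move=> c0 supc.
have fsup i : A i -> (f i <= ereal_sup [set f i | i in A])%E.
  by move=> Ai; apply: ereal_sup_ubound; exists i.
case: (ereal_sup _) supc fsup => [M Mc fM| |_ fN].
(* The maximum with 0 keeps the bound below [c], which is positive, and allows it to be used in
   products and powers. *)
- exists (Num.max 0 M); split.
  + by rewrite le_max lexx.
  + by rewrite EFin_max gt_max c0.
  + by move=> i /fM /le_trans; apply; rewrite lee_fin le_max lexx orbT.
- by rewrite ltNge leey.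
- by exists 0; split => // i /fN /le_trans; apply; exact: leNye.
Qed.

Lemma eq_distribution_ge0_integral d d' (T : measurableType d) (U : measurableType d')
    (R : realType) (P : probability T R) (X Y : {RV P >-> U}) (f : U -> \bar R) :
  distribution P X = distribution P Y :> (set U -> \bar R) ->
  measurable_fun setT f -> (forall y, (0 <= f y)%E) ->
  (\int[P]_w f (X w) = \int[P]_w f (Y w))%E.
Proof.
move=> XY mf f0.
rewrite -(ge0_integral_distribution X)// -(ge0_integral_distribution Y)//.
by apply: eq_measure_integral => A _ _; rewrite [LHS](congr1 (@^~ A) XY).
Qed.

Theorem proposition4p6 (R : realType)
    (chi : nat) (chi_ge2 : (2 <= chi)%N)
    (V : choiceType) (adj : rel V) (bethe : is_bethe_lattice chi adj) (r : V)
    (lam : V -> R) (alpha : V -> V -> R)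
    (adm : admissible adj lam alpha)
    (lam_bounded : (ereal_sup [set (lam v)%:E | v in [set: V]] < +oo)%E)
    (alpha_bounded :
      (ereal_sup [set (alpha e.1 e.2)%:E | e in [set e : V * V | adj e.1 e.2]]
        < 1)%E)
    (d : measure_display) (Omega : measurableType d) (P : probability Omega R)
    (N : nat -> V -> {RV P >-> nat})
    (N_law : forall xi : nat,
      is_mpmrf lam alpha adj (ball_at adj r xi) P (fun v => N xi v))
    (B : V -> {RV P >-> R}) (Bs : V -> nat -> {RV P >-> R})
    (Bs_ge0 : forall (v : V) (j : nat) (w : Omega), 0 <= Bs v j w)
    (Bs_law : forall (v : V) (j : nat),
      distribution P (Bs v j) = distribution P (B v) :> (set R -> \bar R))
    (Bs_indep : forall v : V,
      independent P [set: nat] (fun j => sigma_rv (Bs v j)))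
    (NBs_indep : forall xi : nat,
      independent P
        [set i : option V | if i is Some v then v \in ball_at adj r xi else true]
        (count_claims_sigma (ball_at adj r xi) (fun v => N xi v)
           (fun v j => Bs v j)))
    (B_moment2 :
      (ereal_sup [set 'E_P[fun w => (B v w ^+ 2)%R] | v in [set: V]] < +oo)%E) :
  let W := fun xi : nat =>
    mean_aggregate (ball_at adj r xi) (fun v => N xi v) (fun v j => Bs v j) in
  (forall xi : nat, ('E_P[W xi] < +oo)%E) /\
  (forall eps : R, 0 < eps ->
     P [set w | eps < `|W xi w - fine ('E_P[W xi])%E|] @[xi --> \oo] --> 0%E).
Proof.
move=> W.
have [_ tree _] := bethe.
have [lam_gt0 _ _] := adm.
have [Lam [Lam0 _ lam_le]] := ereal_sup_lt_bound (ltry 0) lam_bounded.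
have [abar [abar0 abar1 alpha_le]] := ereal_sup_lt_bound (@lte01 R) alpha_bounded.
have [S [S0 _ B_le]] := ereal_sup_lt_bound (ltry 0) B_moment2.
have msqr : measurable_fun setT (fun x : R => (x ^+ 2)%:E).
  by apply/measurable_EFinP; exact: measurable_funX.
have Bs2E v j : ('E_P[fun w => (Bs v j w ^+ 2)%R] = 'E_P[fun w => (B v w ^+ 2)%R])%E.
  rewrite !unlock; apply: (eq_distribution_ge0_integral (Bs_law v j) msqr) => y.
  by rewrite lee_fin sqr_ge0.
(* The comparison is with [Bs v 0], nonnegative at every sample point, whereas [B v] is so only in
   law. *)
have Bs1E v j : ('E_P[Bs v j] = 'E_P[Bs v 0%N])%E.
  have normE i : ('E_P[Bs v i] = \int[P]_w (`|Bs v i w|)%:E)%E.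
    by rewrite unlock; apply: eq_integral => w _; rewrite ger0_norm.
  rewrite !normE.
  apply: (@eq_distribution_ge0_integral _ _ _ _ _ _ _ _ (fun x : R => `|x|%:E)) => //.
    by rewrite !Bs_law.
  by apply/measurable_EFinP; exact: normr_measurable.
have B2_fin v : ('E_P[fun w => (B v w ^+ 2)%R])%E \is a fin_num.
  rewrite ge0_fin_numE; first by apply: le_lt_trans (B_le v I) (ltry S).
  by apply: expectation_ge0 => w; exact: sqr_ge0.
have Bs1_fin v : ('E_P[Bs v 0%N])%E \is a fin_num.
  rewrite ge0_fin_numE; last exact: expectation_ge0.
  apply: (le_lt_trans (@expectation_le1sqr _ _ _ P _ (measurable_funPT _) (Bs_ge0 v 0))).
  by rewrite Bs2E lte_add_pinfty ?ltry// -ge0_fin_numE// expectation_ge0// => w; exact: sqr_ge0.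
pose m v := fine ('E_P[Bs v 0%N])%E.
pose s v := fine ('E_P[fun w => (B v w ^+ 2)%R])%E.
have Bs_m v j : ('E_P[Bs v j] = (m v)%:E)%E by rewrite fineK.
have Bs_s v j : ('E_P[fun w => (Bs v j w ^+ 2)%R] = (s v)%:E)%E by rewrite fineK.
have s_le v : s v <= S by rewrite -lee_fin fineK//; exact: B_le.
have {}lam_le v : lam v <= Lam by rewrite -lee_fin; exact: lam_le.
have {}alpha_le u v : adj u v -> alpha u v <= abar.
  by move=> uv; rewrite -lee_fin; exact: (alpha_le (u, v)).
have abar01 : 0 <= abar <= 1 by rewrite abar0 ltW.
have N_moments xi u v := mpmrf_moments adm tree
  (@ball_at_connected _ _ _ bethe r xi) alpha_le (N_law xi) (u := u) (v := v).
have EW xi := expectation_mean_aggregate Bs_ge0 Bs_m (NBs_indep xi) (N_moments xi).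
split; first by move=> xi; rewrite EW ltry.
move=> eps eps0.
have ball_gt0 xi : (0 < #|` ball_at adj r xi|)%N.
  by rewrite cardfs_gt0; apply/fset0Pn; exists r; apply/(in_ball_at bethe); exists [::].
have VW xi k := variance_mean_aggregate_le Bs_ge0 Bs_m Bs_s Bs_indep (NBs_indep xi)
  lam_gt0 lam_le s_le abar01 (N_moments xi) (ball_gt0 xi)
  (fun u => sum_dist_le bethe R (ball_at adj r xi) u k).
set C := (1 + S) ^+ 2 * Lam in VW.
have C0 : 0 <= C by rewrite mulr_ge0 ?sqr_ge0.
(* The constant of the variance bound, divided by eps ^ 2 in Chebyshev's inequality. *)
pose K := eps ^- 2 * C.
have K0 : 0 <= K by rewrite mulr_ge0// invr_ge0 sqr_ge0.
pose A xi := [set w | eps < `|W xi w - fine ('E_P[W xi])%E|].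
have mW xi : measurable_fun setT (W xi) by exact: measurable_mean_aggregate.
have mdev xi : measurable_fun setT (fun w => `|W xi w - fine ('E_P[W xi])%E|).
  by apply: measurableT_comp => //; exact: measurable_funB.
have mA xi : measurable (A xi).
  by rewrite -[X in measurable X]setTI; apply: measurable_fun_ltr.
have mA' xi : measurable [set w | eps <= `|W xi w - fine ('E_P[W xi])%E|].
  by rewrite -[X in measurable X]setTI; apply: measurable_fun_ler.
have PA xi k : (P (A xi) <=
    (K * ((reach_size chi k)%:R / #|` ball_at adj r xi|%:R + abar ^+ k))%:E)%E.
  rewrite -mulrA EFinM; apply: le_trans (lee_wpmul2l _ (VW xi k)); last first.
    by rewrite lee_fin invr_ge0 sqr_ge0.
  apply: le_trans (chebyshev (mfun_Sub (mem_set (mW xi))) eps0).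
  apply: le_measure; first by rewrite inE.
    by rewrite inE; exact: mA'.
  by move=> w /= /ltW.
apply/fine_cvgP; split; first by apply: nearW => xi; exact: fin_num_measure P _ (mA xi).
apply/cvgrPdist_le => e e0.
have e2 : 0 < e / 2 by rewrite divr_gt0.
(* The cut-off distance [k] is fixed before the radius, so that [M] below is a constant while the
   ball grows. *)
have [k abark] : exists k, K * abar ^+ k <= e / 2.
  have Kabar : K * abar ^+ n @[n --> \oo] --> K * 0.
    by apply: cvgMr; apply: cvg_expr; rewrite ger0_norm.
  move/cvgrPdist_le: Kabar => /(_ _ e2)[k _ kP].
  by exists k; have := kP k (leqnn k); rewrite /= mulr0 sub0r normrN ger0_norm// mulr_ge0// exprn_ge0.
pose M : R := (reach_size chi k)%:R.
(* Beyond this radius the ball has more than K * M / (e / 2) vertices, so K * M divided by their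
   number is below e / 2. *)
have [n0 n0P] := ball_at_card_unbounded bethe r (Num.truncn (K * M / (e / 2))).+1.
exists n0 => // xi /= n0xi.
rewrite sub0r normrN ger0_norm ?fine_ge0// -lee_fin fineK; last exact: fin_num_measure P _ (mA xi).
apply: (le_trans (PA xi k)); rewrite -/M lee_fin mulrDr [e]splitr lerD//.
rewrite mulrA ler_pdivrMr ?ltr0n// [e / 2 * _]mulrC -ler_pdivrMr//.
apply: ltW; apply: (lt_le_trans (Num.Theory.truncnS_gt _)).
by rewrite ler_nat; exact: n0P.
Qed.
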